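(* There is an absolute constant $C>0$ such that the following holds. Fix $d,k\in\mathbb N$. Let $A=gg^\top$ with $g\in\mathbb R^{d^k}$ having iid standard normal entries, and let $x=x_1\otimes\cdots\otimes x_k$ with $x_1,\dots,x_k\in\mathbb C^d$ independent (and independent of $g$), each a complex Rademacher or complex Gaussian vector. Then (i) with probability at least $3/4$ over $g$, $\operatorname{Var}[x^*Ax\mid g]\le C(1+\tfrac1d)^k(\operatorname{tr}(A))^2$; and (ii) for every $\varepsilon\in(0,1)$ and every $\ell\ge C\varepsilon^{-2}(1+\tfrac1d)^k$, with probability at least $2/3$ the complex Kronecker–Hutchinson estimator satisfies $|H_\ell(A)-\operatorname{tr}(A)|\le\varepsilon\operatorname{tr}(A)$.
   Context: A complex Rademacher (resp. complex Gaussian) vector is $\frac1{\sqrt2}r+\frac{\mathrm i}{\sqrt2}m$ with $r,m\in\mathbb R^d$ independent vectors of iid Rademacher ($\pm1$ uniform) (resp. standard normal) entries. $x^*$ is the conjugate transpose and $\operatorname{Var}[X]=\mathbb E|X-\mathbb EX|^2$. $H_\ell(A)=\frac1\ell\sum_{j=1}^\ell (x^{(j)})^*Ax^{(j)}$ with $x^{(j)}$ iid copies of $x$. *)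

(* Defs.v *)
From HB Require Import structures.
From mathcomp Require Import all_boot all_order all_algebra.
From mathcomp Require Import all_classical all_reals all_analysis.
From mathcomp Require Import Rstruct Rstruct_topology.
From mathcomp Require Import complex.
Set Implicit Arguments. Unset Strict Implicit. Unset Printing Implicit Defensive.
Import Order.TTheory GRing.Theory Num.Theory.
Local Open Scope classical_set_scope.
Local Open Scope ring_scope.

Notation Rl := Rdefinitions.R.
Notation RM := (measurableTypeR Rl).

(* Index set of R^{d^k} = (C^d)^{\otimes k}: multi-indices u : 'I_k -> 'I_d. *)
Definition tidx (d k : nat) := {ffun 'I_k -> 'I_d}.

(* Index set of all scalar random variables of the model:
   inl u               : entry g_u of the Gaussian vector g,
   inr (c, j, a, true) : entry a of r  for the factor x_j of the c-th copy x^(c),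
   inr (c, j, a, false): entry a of m  for the factor x_j of the c-th copy x^(c). *)
Definition kh_index (d k l : nat) :=
  (tidx d k + ('I_l * 'I_k * 'I_d * bool))%type.

Section defs.
Context {dT : measure_display} {T : measurableType dT} (P : probability T Rl).

Definition mutually_independent (I : finType) (X : I -> T -> Rl) : Prop :=
  forall B : I -> set RM, (forall i, measurable (B i)) ->
    P (\bigcap_i (X i @^-1` B i)) = (\prod_(i : I) P (X i @^-1` B i))%E.

Definition std_normal (X : T -> Rl) : Prop :=
  forall B : set RM, measurable B -> P (X @^-1` B) = normal_prob 0 1 B.

Definition rademacher (X : T -> Rl) : Prop :=
  P (X @^-1` [set 1]) = (1 / 2)%:E /\ P (X @^-1` [set -1]) = (1 / 2)%:E.

(* kind j = true : x_j is complex Gaussian; kind j = false : complex Rademacher. *)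
Definition kh_model (d k l : nat) (kind : 'I_k -> bool)
    (Y : kh_index d k l -> T -> Rl) : Prop :=
  [/\ forall i, measurable_fun [set: T] (Y i : T -> RM),
      mutually_independent Y,
      forall u, std_normal (Y (inl u)) &
      forall c j a b, if kind j then std_normal (Y (inr (c, j, a, b)))
                      else rademacher (Y (inr (c, j, a, b)))].

(* Variance of a complex random variable, Var[Z] = E|Z - EZ|^2
   = Var[Re Z] + Var[Im Z]. *)
Definition cvariance (Z : T -> Rl[i]) : \bar Rl :=
  ('V_P[fun w => complex.Re (Z w)] + 'V_P[fun w => complex.Im (Z w)])%E.
End defs.

Section model.
Context {d k l : nat} {T : Type}.
Variable Y : kh_index d k l -> T -> Rl.

Definition gvec (w : T) (u : tidx d k) : Rl := Y (inl u) w.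

Definition xfac (c : 'I_l) (j : 'I_k) (a : 'I_d) (w : T) : Rl[i] :=
  complex.Complex (Y (inr (c, j, a, true)) w / Num.sqrt 2) (Y (inr (c, j, a, false)) w / Num.sqrt 2).

Definition xtens (c : 'I_l) (w : T) (u : tidx d k) : Rl[i] :=
  \prod_(j < k) xfac c j (u j) w.
End model.

Definition outer {n : finType} (g : n -> Rl) (u v : n) : Rl := g u * g v.

Definition mtrace {n : finType} (A : n -> n -> Rl) : Rl := \sum_u A u u.

Definition qform {n : finType} (A : n -> n -> Rl) (x : n -> Rl[i]) : Rl[i] :=
  \sum_u \sum_v (conjc (x u)) * (A u v)%:C%C * x v.

Definition hutch {n : finType} (l : nat) (A : n -> n -> Rl) (x : 'I_l -> n -> Rl[i]) : Rl[i] :=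
  ((l%:R)^-1)%:C%C * \sum_(c < l) qform A (x c).

Definition cmod (z : Rl[i]) : Rl := ComplexField.Normc.normc z.

(* Main.v *)
Require Import Defs.
From HB Require Import structures.
From mathcomp Require Import all_boot all_order all_algebra.
From mathcomp Require Import all_classical all_reals all_analysis.
From mathcomp Require Import Rstruct Rstruct_topology.
From mathcomp Require Import complex.
From mathcomp Require Import measurable_realfun ring lra.
Set Implicit Arguments.
Unset Strict Implicit.
Unset Printing Implicit Defensive.
Import Order.TTheory GRing.Theory Num.Theory.
Import numFieldNormedType.Exports.
Local Open Scope classical_set_scope.
Local Open Scope ring_scope.

(** Since [x^* A x = |<g, x>|^2], everything reduces to second moments of
    [conj (x u) * x v - [u = v]].  Averaging over [g] with the Wick formula for
    [E (g u * g v * g s * g t)] leaves three double sums over multi-indices, and each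
    factors over the [k] tensor legs; a leg contributes at most [d^2 + d], because
    [E x_a^2 = 0], [E |x_a|^2 = 1] and [E |x_a|^4 <= 2] for both kinds of entries.
    With [n = d^k] this gives [E Var (x^* A x | g) <= 3 n^2 (1 + 1/d)^k], and the mean
    square error of the estimator is at most this bound divided by [l], the cross
    terms between different copies of [x] being zero.  Markov's inequality concludes
    once [tr A = |g|^2] is known to be at least [n / 2048] with probability [7/8]: this
    holds because few coordinates of [g] can lie in [[-1/32, 1/32]]. *)

(** * Expectation of a product of functions of independent variables *)

(** Averaging over [g] cannot be avoided: if [g] is a coordinate vector and the factors are
    Gaussian, the trace is 1 and the variance is [2^k - 1], which for [d >= 2] no fixed multiple of
    [(1 + 1/d)^k] bounds for all [k]. All variables live on one space with no product structure, so
    conditioning on [g] means freezing [g] in a polynomial whose coefficients are moments of [x].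
    For the same reason (ii) is not deduced from (i): the squared error is averaged over all
    variables at once. Independence is given for events only, hence the work on expectations of
    products. Gaussian and Rademacher entries enter the second moments only through mean 0, variance
    1 and fourth moment at most 3, so [kind] disappears from that computation. The lower bound on
    the trace must cover [n = 1] ([k = 0] or [d = 1]), where Chebyshev for [|g|^2] says nothing; a
    small-ball estimate works for every [n]. *)

Lemma Rintegral_sum {d : measure_display} {T : measurableType d} {R : realType}
    (mu : {measure set T -> \bar R}) (J : Type) (s : seq J) (F : J -> T -> R) :
  (forall j, mu.-integrable [set: T] (fun x => (F j x)%:E)) ->
  \int[mu]_x (\sum_(j <- s) F j x) = \sum_(j <- s) \int[mu]_x F j x.
Proof.
move=> intF; elim: s => [|j s IH].
  under eq_Rintegral do rewrite big_nil.
  by rewrite big_nil /Rintegral integral0.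
rewrite big_cons -IH -RintegralD//.
  by apply: eq_Rintegral => x _; rewrite big_cons.
  exact: intF.
have -> : EFin \o (fun x => \sum_(j <- s) F j x) =
    fun x => (\sum_(j <- s) (F j x)%:E)%E.
  by apply/funext => x /=; rewrite sumEFin.
exact: integrable_sum.
Qed.

(** * Integration against the image of a weighted measure *)

Section density.
Local Open Scope ereal_scope.
Context {d1 d2 : measure_display} {X : measurableType d1} {T : measurableType d2}.
Context {R : realType}.
Variables (nu : {measure set X -> \bar R}) (mu : {measure set T -> \bar R}).
Variables (phi : T -> X) (G : T -> R).
Hypothesis mphi : measurable_fun [set: T] phi.
Hypothesis mG : measurable_fun [set: T] G.
Hypothesis G0 : forall x, (0 <= G x)%R.
Hypothesis nuE : forall B : set X, measurable B ->
  nu B = \int[mu]_x ((G x)%:E * (\1_B (phi x))%:E).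

Import HBNNSimple.

Let ge0_integral_density_nnsfun (h : {nnsfun X >-> R}) :
  \int[nu]_y (h y)%:E = \int[mu]_x ((G x)%:E * (h (phi x))%:E).
Proof.
have mB r : measurable (h @^-1` [set r]).
  by rewrite -[X in measurable X]setTI; exact: measurable_funP.
rewrite integralT_nnsfun sintegralE.
under [RHS]eq_integral.
  move=> x _; rewrite fimfunE -fsumEFin// ge0_mule_fsumr; last first.
    by move=> r; rewrite EFinM nnfun_muleindic_ge0.
  over.
have mI r : measurable_fun [set: T] (fun x => (\1_(h @^-1` [set r]) (phi x))%:E : \bar R).
  apply/measurable_EFinP.
  exact: (@measurableT_comp _ _ _ _ _ _ (\1_(h @^-1` [set r]) : X -> R)).
have mGE : measurable_fun [set: T] (EFin \o G) by exact/measurable_EFinP.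
rewrite ge0_integral_fsum//; last 2 first.
- move=> r; under eq_fun do rewrite EFinM muleCA.
  by apply: measurable_funeM; exact: emeasurable_funM.
- by move=> r x _; apply: mule_ge0; rewrite ?lee_fin// -lee_fin EFinM nnfun_muleindic_ge0.
apply: eq_fsbigr => r; rewrite inE => -[y _ <-].
under eq_integral do rewrite EFinM muleCA.
rewrite ge0_integralZl//.
- by rewrite nuE.
- by apply: emeasurable_funM.
- by move=> x _; rewrite mule_ge0// lee_fin.
- by rewrite lee_fin.
Qed.

(** [nu] is the image under [phi] of [mu] weighted by [G], known only through its values on sets;
    simple functions and monotone convergence extend the identity. It serves twice: with [phi] one
    variable of an independent family and [G] the product of the other factors, and with [phi] the
    identity and [G] the normal density. *)
Lemma ge0_integral_density (h : X -> \bar R) :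
  measurable_fun [set: X] h -> (forall y, 0 <= h y) ->
  \int[nu]_y h y = \int[mu]_x ((G x)%:E * h (phi x)).
Proof.
move=> mh h0; pose h_ := nnsfun_approx measurableT mh.
have cvgh y : (h_ n y)%:E @[n --> \oo] --> h y by exact: cvg_nnsfun_approx.
transitivity (limn (fun n => \int[nu]_y (h_ n y)%:E)).
  rewrite -monotone_convergence//=.
  - by apply: eq_integral => y _; apply/esym/cvg_lim => //; exact: cvgh.
  - by move=> n; apply/measurable_EFinP.
  - by move=> n y _; rewrite lee_fin.
  - by move=> y _ a b ab; rewrite lee_fin; exact/lefP/nd_nnsfun_approx.
under eq_fun do rewrite ge0_integral_density_nnsfun.
rewrite -monotone_convergence//=.
- by apply: eq_integral => x _; apply/cvg_lim => //; exact: cvgeZl.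
- move=> n; apply: emeasurable_funM => //; apply/measurable_EFinP => //.
  exact: measurableT_comp.
- by move=> n x _; rewrite mule_ge0// lee_fin.
- move=> x _ a b ab; rewrite lee_wpmul2l ?lee_fin//.
  exact/lefP/nd_nnsfun_approx.
Qed.

End density.

(** * Independence: from events to expectations *)

Section independence.
Local Open Scope ereal_scope.
Context {dT : measure_display} {T : measurableType dT} {R : realType}.
Context (P : probability T R) {I : finType} (Y : I -> T -> R).
Hypothesis mY : forall i, measurable_fun [set: T] (Y i).
Hypothesis indepY : forall B : I -> set R, (forall i, measurable (B i)) ->
  P (\bigcap_i (Y i @^-1` B i)) = \prod_i P (Y i @^-1` B i).

Let mcomp i (f : R -> R) : measurable_fun [set: R] f ->
  measurable_fun [set: T] (fun w => f (Y i w)).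
Proof. by move=> mf; exact: (@measurableT_comp _ _ _ _ _ _ f). Qed.

Lemma ge0_expectation_prod (f : I -> R -> R) :
  (forall i, measurable_fun [set: R] (f i)) ->
  (forall i x, 0 <= f i x)%R ->
  (forall i, \int[P]_w (f i (Y i w))%:E < +oo) ->
  \int[P]_w (\prod_i f i (Y i w))%:E = \prod_i \int[P]_w (f i (Y i w))%:E.
Proof.
(* Turn the factors from indicators into general functions one index at a time. *)
suff H (s : seq I) (f0 : I -> R -> R) :
    (forall i, measurable_fun [set: R] (f0 i)) ->
    (forall i x, 0 <= f0 i x)%R ->
    (forall i, \int[P]_w (f0 i (Y i w))%:E < +oo) ->
    (forall i, i \notin s -> exists2 B : set R, measurable B & f0 i = \1_B) ->
    \int[P]_w (\prod_i f0 i (Y i w))%:E = \prod_i \int[P]_w (f0 i (Y i w))%:E.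
  by move=> *; apply: (H (enum I)) => // i; rewrite mem_enum.
have mYB i (B : set R) : measurable B -> measurable (Y i @^-1` B).
  by move=> mB; rewrite -[X in measurable X]setTI; exact: mY.
elim: s f0 => [|i s IH] f0 mf f_ge0 ffin fI.
  have {}fI i : {B : set R | measurable B & f0 i = \1_B} by exact/cid2/fI.
  pose B i := s2val (fI i).
  have mB i : measurable (B i) by exact: s2valP (fI i).
  have fE i w : f0 i (Y i w) = \1_(Y i @^-1` B i) w.
    by rewrite (s2valP' (fI i)).
  under eq_integral.
    move=> w _.
    rewrite (_ : (\prod_i0 _)%R = \1_(\bigcap_i (Y i @^-1` B i)) w); last first.
      rewrite indicE; case: (boolP (w \in _)) => [|/negP].
        rewrite inE => h; rewrite big1// => i _.
        by rewrite fE indicE mem_set//; exact: h.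
      move=> h; have [i /negP hi] : exists i, ~ (w \in Y i @^-1` B i).
        apply/existsNP => h'; apply: h; rewrite inE => i _.
        by have := h' i; rewrite inE.
      by rewrite (bigD1 i)//= fE indicE (negbTE hi) mul0r.
    over.
  rewrite integral_indic ?setIT//; last first.
    by apply: fin_bigcap_measurable => // i _; exact: mYB.
  rewrite [LHS](indepY mB); apply: eq_bigr => i _.
  by under eq_integral do rewrite fE; rewrite integral_indic ?setIT//; exact: mYB.
pose G w := (\prod_(j | j != i) f0 j (Y j w))%R.
have mG : measurable_fun [set: T] G.
  rewrite /G; under eq_fun do rewrite -big_filter.
  by apply: measurable_prod => j _; exact: mcomp.
have G0 w : (0 <= G w)%R by exact: prodr_ge0.
pose c := \prod_(j | j != i) \int[P]_w (f0 j (Y j w))%:E.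
have c0 : 0 <= c.
  by apply: prode_ge0 => j _; apply: integral_ge0 => w _; rewrite lee_fin.
(* [mscale] below takes a real scalar, so the expected product of the other factors has to be
   finite. *)
have cfin : c \is a fin_num.
  apply: prode_fin_num => j _; rewrite ge0_fin_numE//.
  by apply: integral_ge0 => w _; rewrite lee_fin.
have c0' : (0 <= fine c)%R by exact: fine_ge0.
pose k : {nonneg R} := NngNum c0'.
pose X : {mfun T >-> R} := HB.pack (Y i) (isMeasurableFun.Build _ _ _ _ _ (mY i)).
pose nu : {measure set R -> \bar R} := mscale k (distribution P X).
(* With [\1_B] in place of the factor [i], one index fewer remains to be treated and the induction
   hypothesis applies. It says that [c] times the law of [Y i] is the image under [Y i] of [P]
   weighted by [G]; integrating [f0 i] against this measure gives the step. *)
have nuE (B : set R) : measurable B ->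
    nu B = \int[P]_w ((G w)%:E * (\1_B (Y i w))%:E).
  move=> mB.
  pose f1 j := if j == i then \1_B else f0 j.
  have IH1 : \int[P]_w (\prod_i f1 i (Y i w))%:E = \prod_i \int[P]_w (f1 i (Y i w))%:E.
    apply: IH => j.
    - by rewrite /f1; case: eqP => // _; exact: measurable_indic.
    - by move=> x; rewrite /f1; case: eqP => // _; rewrite indicE.
    - rewrite /f1; case: eqP => [->|_]; last exact: ffin.
      under eq_integral do rewrite -[\1_B (Y i _)]/(\1_(Y i @^-1` B) _).
      rewrite integral_indic ?setIT//; last exact: mYB.
      by rewrite (le_lt_trans (probability_le1 P (mYB _ _ mB)))// ltry.
    - move=> js; rewrite /f1; case: eqP => [_|/eqP ji]; first by exists B.
      by apply: fI; rewrite inE negb_or ji.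
  transitivity (\int[P]_w (\prod_i f1 i (Y i w))%:E); last first.
    apply: eq_integral => w _; rewrite -EFinM; congr EFin.
    rewrite (bigD1 i)//= /f1 eqxx mulrC; congr (_ * _)%R.
    by apply: eq_bigr => j /negbTE ->.
  rewrite IH1 (bigD1 i)//= {1}/f1 eqxx.
  under eq_integral do rewrite -[\1_B (Y i _)]/(\1_(Y i @^-1` B) _).
  rewrite integral_indic ?setIT//; last exact: mYB.
  rewrite /nu /mscale/= fineK// muleC; congr (_ * _).
  by apply: eq_bigr => j /negbTE ji; rewrite /f1 ji.
have mfE j : measurable_fun [set: R] (EFin \o f0 j) by exact/measurable_EFinP.
transitivity (\int[P]_w ((G w)%:E * (f0 i (Y i w))%:E)).
  by apply: eq_integral => w _; rewrite (bigD1 i)//= mulrC EFinM.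
rewrite -(ge0_integral_density (nu := nu) (mY i) mG G0 nuE (mfE i)); last first.
  by move=> y; rewrite lee_fin.
rewrite ge0_integral_mscale//; last by move=> y _; rewrite lee_fin.
rewrite ge0_integral_distribution//; last by move=> y; rewrite lee_fin.
rewrite [in RHS](bigD1 i)//= fineK// muleC.
by [].
Qed.

Lemma integrable_prod_indep (f : I -> R -> R) :
  (forall i, measurable_fun [set: R] (f i)) ->
  (forall i, P.-integrable [set: T] (fun w => (f i (Y i w))%:E)) ->
  P.-integrable [set: T] (fun w => (\prod_i f i (Y i w))%:E).
Proof.
move=> mf intf; apply/integrableP; split.
  by apply/measurable_EFinP/measurable_prod => i _; exact: mcomp.
under eq_integral do rewrite abse_EFin normr_prod.
rewrite (@ge0_expectation_prod (fun i x => `|f i x|%R))//=.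
- rewrite -ge0_fin_numE.
    apply: prode_fin_num => i _; rewrite ge0_fin_numE ?integral_ge0//.
    by have /integrableP[] := intf i.
  by apply: prode_ge0 => i _; rewrite integral_ge0.
- by move=> i; exact: measurableT_comp.
- by move=> i; have /integrableP[] := intf i.
Qed.

Let ge0_Rintegral_prod_indep (f : I -> R -> R) :
  (forall i, measurable_fun [set: R] (f i)) ->
  (forall i x, 0 <= f i x)%R ->
  (forall i, P.-integrable [set: T] (fun w => (f i (Y i w))%:E)) ->
  (\int[P]_w (\prod_i f i (Y i w)) = \prod_i \int[P]_w f i (Y i w))%R.
Proof.
move=> mf f0 intf; rewrite /Rintegral ge0_expectation_prod//.
- rewrite (eq_bigr (fun i => (fine (\int[P]_w (f i (Y i w))%:E))%:E)).
    by rewrite prodEFin.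
  by move=> i _; rewrite fineK//; exact: integrable_fin_num.
- move=> i; have /integrableP[_] := intf i.
  by under eq_integral do rewrite abse_EFin ger0_norm//.
Qed.

(** Splitting each factor into positive and negative parts turns the product into a signed sum, over
    the sign choices [phi], of products of nonnegative functions. The nonnegative case applies to
    each term, and the same expansion read backwards reassembles the right-hand side. *)
Lemma Rintegral_prod_indep (f : I -> R -> R) :
  (forall i, measurable_fun [set: R] (f i)) ->
  (forall i, P.-integrable [set: T] (fun w => (f i (Y i w))%:E)) ->
  (\int[P]_w (\prod_i f i (Y i w)) = \prod_i \int[P]_w f i (Y i w))%R.
Proof.
move=> mf intf.
pose sg (b : bool) : R := if b then 1%R else (-1)%R.
pose h i b x : R := Num.max (sg b * f i x)%R 0%R.
have fE i x : f i x = (\sum_(b : bool) sg b * h i b x)%R.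
  rewrite big_bool /h /sg /= !mul1r !mulN1r /Num.max.
  by case: ltP => ?; case: ltP => ?; lra.
have mh i b : measurable_fun [set: R] (h i b).
  by apply: measurable_maxr => //; exact: measurable_funM.
have h0 i b x : (0 <= h i b x)%R by rewrite /h le_max lexx orbT.
have inth i b : P.-integrable [set: T] (fun w => (h i b (Y i w))%:E).
  apply: le_integrable (intf i) => //; first exact/measurable_EFinP/mcomp.
  move=> w _; rewrite !abse_EFin lee_fin ger0_norm//.
  rewrite /h ge_max normr_ge0 andbT (le_trans (ler_norm _))// normrM /sg.
  by case: b; rewrite ?normrN1 ?normr1 mul1r.
under eq_Rintegral.
  move=> w _; under eq_bigr do rewrite fE.
  rewrite bigA_distr_bigA/=.
  under eq_bigr do rewrite big_split/=.
  over.
rewrite Rintegral_sum; last first.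
  move=> phi; under eq_fun do rewrite EFinM.
  by apply: integrableZl => //; exact: (integrable_prod_indep (f := fun i => h i (phi i))).
transitivity (\prod_i \sum_(b : bool) sg b * \int[P]_w h i b (Y i w))%R.
  rewrite bigA_distr_bigA; apply: eq_bigr => phi _.
  rewrite RintegralZl//; last exact: (integrable_prod_indep (f := fun i => h i (phi i))).
  by rewrite big_split/= (ge0_Rintegral_prod_indep (f := fun i => h i (phi i))).
apply: eq_bigr => i _; under [RHS]eq_Rintegral do rewrite fE.
rewrite Rintegral_sum; last first.
  by move=> b; under eq_fun do rewrite EFinM; exact: integrableZl.
by apply: eq_bigr => b _; rewrite RintegralZl//; exact: inth.
Qed.

End independence.

(** * Moments of the normal and Rademacher laws *)

Section normal_moments.
Context {R : realType}.
Local Notation mu := (@lebesgue_measure R).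
Local Notation phi := (@normal_pdf R 0 1).

Let phiE x : phi x = normal_peak 1 * expR (- x ^+ 2 / 2).
Proof.
by rewrite normal_pdfE ?oner_neq0// /normal_fun subr0 expr1n.
Qed.

Let phi_ge0 x : 0 <= phi x. Proof. exact: normal_pdf_ge0. Qed.

Let cphi : continuous phi.
Proof. by apply: continuous_normal_pdf; rewrite oner_neq0. Qed.

Let is_derive_phi (x : R) : is_derive x 1 (phi : R -> R) (- (x * phi x)).
Proof.
rewrite (_ : phi = fun x => normal_peak 1 * expR (- x ^+ 2 / 2)); last exact/funext/phiE.
have H : is_derive x 1 (fun x : R => - x ^+ 2 / 2) (- x).
  apply: is_derive_eq; rewrite /GRing.scale/= ?derive_cst; by [field|lra].
apply: is_derive_eq.
rewrite /GRing.scale/=.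
ring.
Qed.

Let phi_even x : phi (- x) = phi x.
Proof. by rewrite !phiE sqrrN. Qed.

Let cvg_phi m : n.+1%:R ^+ m * phi n.+1%:R @[n --> \oo] --> (0 : R).
Proof.
(* The exponential series bounds [expR (x ^+ 2 / 2)] below by [x ^+ (2 * m.+1) / C], hence by
   [x ^+ m.+1 / C] for [x >= 1]. The power beyond [m] leaves a factor [1 / x], which tends to 0. *)
pose C : R := 2 ^+ m.+1 * (m.+1)`!%:R.
have C0 : 0 < C by rewrite mulr_gt0 ?exprn_gt0// ltr0n fact_gt0.
have bnd (n : nat) : n.+1%:R ^+ m * phi n.+1%:R <= normal_peak 1 * C / n.+1%:R.
  rewrite phiE mulrCA -mulrA ler_pM2l ?normal_peak_gt0 ?oner_neq0//.
  set x : R := n.+1%:R; have x1 : 1 <= x by rewrite ler1n.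
  have x0 : 0 < x by rewrite ltr0n.
  have e0 := expR_gt0 (x ^+ 2 / 2).
  have := @expR_ge1Dxn R (x ^+ 2 / 2) m (divr_ge0 (sqr_ge0 _) (ler0n _ _)).
  rewrite expr_div_n -exprM -mulrA -invfM -/C => H.
  rewrite mulNr expRN ler_pdivrMr// mulrAC ler_pdivlMr// -exprSr.
  have H2 : x ^+ m.+1 / C <= expR (x ^+ 2 / 2).
    apply: le_trans H; apply: (@le_trans _ _ (x ^+ (2 * m.+1) / C)); last by rewrite lerDr.
    by rewrite ler_pM2r ?invr_gt0// ler_weXn2l// leq_pmull.
  by move: H2; rewrite ler_pdivrMr// mulrC.
apply: (@squeeze_cvgr _ _ _ _ (cst 0) (fun n => normal_peak 1 * C / n.+1%:R)).
- by near=> n; rewrite bnd andbT mulr_ge0// exprn_ge0.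
- exact: cvg_cst.
- rewrite -[X in _ --> X](mulr0 (normal_peak 1 * C)).
  apply: cvgM; first exact: cvg_cst.
  exact: cvg_harmonic.
Unshelve. all: by end_near. Qed.

Let mmoment m : measurable_fun [set: R] (fun x : R => x ^+ m * phi x).
Proof.
apply: measurable_funM; last exact: measurable_normal_pdf.
exact: measurable_funX.
Qed.

(** Integration by parts of [x ^+ m.+1] against [x * phi x], the derivative of [- phi]. On [[0, b]]
    only the endpoint [b] gives a boundary term; letting [b = n.+1] tend to infinity gives the half
    line, and evenness then gives the recursion for even moments on the whole line. *)
Let moment_itv m (b : R) : 0 < b ->
  (\int[mu]_(x in `[0%R, b]) (x ^+ m.+2 * phi x)%:E =
  (- (b ^+ m.+1 * phi b))%:E + (m.+1%:R)%:E * \int[mu]_(x in `[0%R, b]) (x ^+ m * phi x)%:E)%E.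
Proof.
move=> b0.
have cX k : continuous (fun x : R => x ^+ k) by exact: exprn_continuous.
transitivity (\int[mu]_(x in `[0%R, b]) ((- x ^+ m.+1) * (- (x * phi x)))%:E)%E.
  by apply: eq_integral => x _; rewrite mulrNN mulrA -exprSr.
have ibp := @integration_by_parts R (fun x => - x ^+ m.+1) phi (fun x => - (m.+1%:R * x ^+ m))
  (fun x => - (x * phi x)) 0 b b0.
rewrite ibp.
- rewrite expr0n/= oppr0 mul0r subr0 mulNr; congr (_ + _)%E.
  transitivity (- \int[mu]_(x in `[0%R, b]) (- ((m.+1%:R)%:E * (x ^+ m * phi x)%:E)))%E.
    by congr (- _)%E; apply: eq_integral => x _; rewrite -EFinM mulNr mulrA EFinN.
  have x0 x : `[0%R, b]%classic x -> 0 <= x by rewrite /= in_itv/= => /andP[].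
  rewrite integral_ge0N ?oppeK; last first.
    by move=> x /x0 {}x0; rewrite -EFinM lee_fin !mulr_ge0// exprn_ge0.
  rewrite ge0_integralZl//.
  - by apply/measurable_EFinP/measurable_funTS; exact: mmoment.
  - by move=> x /x0 {}x0; rewrite lee_fin mulr_ge0// exprn_ge0.
- apply: continuous_subspaceT => x; apply: cvgN; apply: cvgM; first exact: cvg_cst.
  exact: cX.
- split.
  + by move=> x _; apply: derivableN; exact: exprn_derivable.
  + by apply: cvgN; apply: cvg_at_right_filter; exact: cX.
  + by apply: cvgN; apply: cvg_at_left_filter; exact: cX.
- move=> x _; rewrite derive1E deriveN; last exact: exprn_derivable.
  by rewrite exp_derive /GRing.scale/= mulr1.
- apply: continuous_subspaceT => x; apply: cvgN; apply: cvgM; first exact: cvg_id.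
  exact: cphi.
- split.
  + by move=> x _; have [] := is_derive_phi x.
  + by apply: cvg_at_right_filter; exact: cphi.
  + by apply: cvg_at_left_filter; exact: cphi.
- by move=> x _; rewrite derive1E; exact: derive_val.
Qed.

Let moment_half m :
  (\int[mu]_(x in `[0%R, +oo[) (x ^+ m.+2 * phi x)%:E =
  (m.+1%:R)%:E * \int[mu]_(x in `[0%R, +oo[) (x ^+ m * phi x)%:E)%E.
Proof.
have cvgI k : (\int[mu]_(x in `[0%R, n.+1%:R]) (x ^+ k * phi x)%:E @[n --> \oo] -->
    \int[mu]_(x in `[0%R, +oo[) (x ^+ k * phi x)%:E)%E.
  rewrite itv0y_bigcup0S; apply: ge0_nondecreasing_set_cvg_integral => //.
  - move=> a b ab; rewrite subsetEset; apply: subset_itvl.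
    by rewrite bnd_simp ler_nat.
  - by move=> n; apply/measurable_EFinP/measurable_funTS; exact: mmoment.
  - move=> n x; rewrite /= in_itv/= => /andP[x0 _].
    by rewrite lee_fin mulr_ge0// exprn_ge0.
set L := (X in _ = X); have /cvg_lim <- // := cvgI m.+2; apply/cvg_lim => //.
under eq_fun do rewrite moment_itv ?ltr0n//.
rewrite -[L]add0e; apply: cvgeD => //.
- apply: cvg_EFin; first exact: nearW.
  have := @cvgN _ _ _ _ eventually_filter _ _ (cvg_phi m.+1).
  by rewrite oppr0; apply.
- exact: cvgeZl.
Qed.

Let normal_moment k : (\int[mu]_x (x ^+ k.*2.+2 * phi x)%:E =
  (k.*2.+1%:R)%:E * \int[mu]_x (x ^+ k.*2 * phi x)%:E)%E.
Proof.
have sym j : (\int[mu]_x (x ^+ j.*2 * phi x)%:E =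
    2%:E * \int[mu]_(x in `[0%R, +oo[) (x ^+ j.*2 * phi x)%:E)%E.
  rewrite ge0_symfun_integralT ?set_itvcy//.
  - by move=> x; rewrite mulr_ge0// exprn_even_ge0// odd_double.
  - by move=> x; apply: cvgM; [exact: exprn_continuous|exact: cphi].
  - move=> x /=; rewrite phi_even; congr (_ * _).
    by rewrite exprNn -signr_odd odd_double mul1r.
by rewrite -doubleS !sym moment_half muleCA.
Qed.

Lemma normal_moment0 : (\int[mu]_x (x ^+ 0 * phi x)%:E = 1)%E.
Proof. by under eq_integral do rewrite mul1r; exact: integral_normal_pdf. Qed.

Lemma normal_moment2 : (\int[mu]_x (x ^+ 2 * phi x)%:E = 1)%E.
Proof. by rewrite (normal_moment 0) normal_moment0 mule1. Qed.

Lemma normal_moment4 : (\int[mu]_x (x ^+ 4 * phi x)%:E = 3%:E)%E.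
Proof. by rewrite (normal_moment 1) normal_moment2 mule1. Qed.

Lemma normal_moment_even_fin_num k :
  (\int[mu]_x (x ^+ k.*2 * phi x)%:E \is a fin_num)%E.
Proof.
elim: k => [|k IH]; first by rewrite normal_moment0.
by rewrite doubleS normal_moment fin_numM.
Qed.

End normal_moments.

Section normal_variable.
Local Open Scope ereal_scope.
Context {dT : measure_display} {T : measurableType dT} {R : realType}.
Context (P : probability T R) (X : T -> R).
Hypothesis mX : measurable_fun [set: T] X.
Hypothesis lawX : forall B : set R, measurable B -> P (X @^-1` B) = normal_prob 0 1 B.
Local Notation mu := (@lebesgue_measure R).
Local Notation phi := (@normal_pdf R 0 1).

Lemma ge0_integral_normal (h : R -> R) : measurable_fun [set: R] h ->
  (forall x, 0 <= h x)%R ->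
  \int[P]_w (h (X w))%:E = \int[mu]_x (h x * phi x)%:E.
Proof.
move=> mh h0.
pose X' : {mfun T >-> R} := HB.pack X (isMeasurableFun.Build _ _ _ _ _ mX).
have mhE : measurable_fun [set: R] (EFin \o h) by exact/measurable_EFinP.
have hE0 y : 0 <= (EFin \o h) y by rewrite lee_fin.
have nuE (B : set R) : measurable B ->
    distribution P X' B = \int[mu]_x ((phi x)%:E * (\1_B x)%:E).
  move=> mB; rewrite /distribution /pushforward/= lawX// /normal_prob.
  rewrite integral_mkcond; apply: eq_integral => x _.
  by rewrite epatch_indic.
have mid : measurable_fun [set: R] (@idfun R) by exact: measurable_id.
have mphi : measurable_fun [set: R] phi by exact: measurable_normal_pdf.
have phi0 x : (0 <= phi x)%R by exact: normal_pdf_ge0.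
have := ge0_integral_density (nu := distribution P X') (mu := mu) mid mphi phi0 nuE mhE hE0.
rewrite ge0_integral_distribution// => -> /=.
by apply: eq_integral => x _; rewrite -EFinM mulrC.
Qed.

Lemma integrable_normalX n : P.-integrable [set: T] (fun w => (X w ^+ n)%:E).
Proof.
apply/integrableP; split; first exact/measurable_EFinP/measurable_funX.
under eq_integral do rewrite abse_EFin.
rewrite (@ge0_integral_normal (fun x => `|x ^+ n|%R))//; last first.
  by apply: measurableT_comp => //; exact: measurable_funX.
have mphi k : measurable_fun [set: R] (fun x : R => (x ^+ k * phi x)%R).
  apply: measurable_funM; last exact: measurable_normal_pdf.
  exact: measurable_funX.
have phi0 x : (0 <= phi x)%R by exact: normal_pdf_ge0.
have X0 x : (0 <= x ^+ n.*2 :> R)%R by rewrite exprn_even_ge0// odd_double.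
(* The bound [|x^n| <= 1 + x^(2n)] reduces every power to even moments, which the recursion shows to
   be finite. *)
apply: (@le_lt_trans _ _ (\int[mu]_x ((x ^+ 0 * phi x)%:E + (x ^+ n.*2 * phi x)%:E))).
  apply: ge0_le_integral => //.
  - by move=> x _; rewrite lee_fin mulr_ge0.
  - apply/measurable_EFinP; apply: measurable_funM; last exact: measurable_normal_pdf.
    by apply: measurableT_comp => //; exact: measurable_funX.
  - by apply: emeasurable_funD; apply/measurable_EFinP; exact: mphi.
  - move=> x _; rewrite -EFinD lee_fin -mulrDl ler_wpM2r// expr0.
    rewrite -muln2 exprM; have := sqr_ge0 (`|x ^+ n| - 1)%R.
    rewrite -(real_normK (num_real (x ^+ n)))%R; have := normr_ge0 (x ^+ n)%R; nra.
rewrite ge0_integralD//; last 4 first.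
- by move=> x _; rewrite lee_fin mulr_ge0.
- by apply/measurable_EFinP; exact: mphi.
- by move=> x _; rewrite lee_fin mulr_ge0.
- by apply/measurable_EFinP; exact: mphi.
by rewrite normal_moment0 lte_add_pinfty ?ltry// ltey_eq normal_moment_even_fin_num.
Qed.

Let ge0_integral_opp (h : R -> \bar R) : measurable_fun [set: R] h ->
  (forall x, 0 <= h x) -> \int[mu]_x h (- x)%R = \int[mu]_x h x.
Proof.
move=> mh h0.
transitivity (\int[pushforward mu (-%R : _ -> measurableTypeR R)]_x h x).
  by rewrite ge0_integral_pushforward//= preimage_setT.
by apply: eq_measure_integral => A mA _; exact: lebesgue_measureN.
Qed.

(** The recursion was set up for even orders. For the mean, evenness of the density gives the
    positive and negative parts of [X] the same integral. *)
Lemma Rintegral_normal1 : (\int[P]_w X w = 0)%R.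
Proof.
pose p (x : R) : R := Num.max x 0%R.
have mp : measurable_fun [set: R] p by exact: measurable_maxr.
have mpN : measurable_fun [set: R] (fun x => p (- x)%R) by exact: measurableT_comp.
have p0 x : (0 <= p x)%R by rewrite /p le_max lexx orbT.
have intX : P.-integrable [set: T] (fun w => (X w)%:E) by exact: (integrable_normalX 1).
have le_p (x : R) : (p x <= `|x|)%R by rewrite /p ge_max normr_ge0 ler_norm.
have intp : P.-integrable [set: T] (fun w => (p (X w))%:E).
  apply: le_integrable intX => //; first exact/measurable_EFinP/measurableT_comp.
  by move=> w _; rewrite !abse_EFin lee_fin ger0_norm.
have intpN : P.-integrable [set: T] (fun w => (p (- X w))%:E).
  apply: le_integrable intX => //.
    by apply/measurable_EFinP; exact: (measurableT_comp mpN mX).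
  by move=> w _; rewrite !abse_EFin lee_fin ger0_norm// -(normrN (X w)).
transitivity (\int[P]_w (p (X w) - p (- X w)))%R.
  apply: eq_Rintegral.
  by move=> w _; rewrite /p /Num.max; case: ltP => ?; case: ltP => ?; lra.
rewrite RintegralB// /Rintegral.
rewrite (@ge0_integral_normal (fun x => p (- x))%R)// ge0_integral_normal//.
apply/eqP; rewrite subr_eq0; apply/eqP; congr fine.
rewrite -(@ge0_integral_opp (fun x => (p x * phi x)%:E)).
- apply: eq_integral => x _; congr (_ * _)%:E.
  by rewrite !normal_pdfE ?oner_neq0// /normal_fun !subr0 sqrrN.
- apply/measurable_EFinP/measurable_funM => //; exact: measurable_normal_pdf.
- by move=> x; rewrite lee_fin mulr_ge0// normal_pdf_ge0.
Qed.

Lemma Rintegral_normal2 : (\int[P]_w (X w ^+ 2) = 1)%R.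
Proof.
rewrite /Rintegral (@ge0_integral_normal (fun x => x ^+ 2)%R) ?normal_moment2//.
by move=> x; exact: sqr_ge0.
Qed.

Lemma Rintegral_normal4 : (\int[P]_w (X w ^+ 4) = 3)%R.
Proof.
rewrite /Rintegral (@ge0_integral_normal (fun x => x ^+ 4)%R) ?normal_moment4//.
by move=> x; exact: exprn_even_ge0.
Qed.

(** The density never exceeds [1 / sqrt (2 pi) <= 1], and the interval has length [2 * s]. *)
Lemma normal_small_ball (s : R) : (0 <= s)%R ->
  P [set w | (`|X w| <= s)%R] <= (2 * s)%:E.
Proof.
move=> s0; have -> : [set w | (`|X w| <= s)%R] = X @^-1` `[(- s)%R, s]%classic.
  by apply/seteqP; split=> w /=; rewrite in_itv/= ler_norml.
rewrite lawX//; apply: (@le_trans _ _ (\int[mu]_(x in `[(- s)%R, s]%classic) (cst 1 x))).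
  apply: ge0_le_integral => //.
  - by move=> x _; rewrite lee_fin normal_pdf_ge0.
  - by apply/measurable_EFinP/measurable_funTS; exact: measurable_normal_pdf.
  - move=> x _; rewrite lee_fin (le_trans (normal_pdf_ub _ _ _)) ?oner_neq0//.
    rewrite /normal_peak invf_le1 ?sqrtr_gt0; last first.
      by rewrite expr1n mul1r mulrn_wgt0// pi_gt0.
    rewrite -[leLHS]sqrtr1 ler_wsqrtr// expr1n mul1r.
    by have := @pi_ge2 R; lra.
rewrite integral_cst//= mul1e lebesgue_measure_itv/= lte_fin.
case: ifP => _; last by rewrite lee_fin mulr_ge0.
by rewrite -EFinD lee_fin; lra.
Qed.

End normal_variable.


Section rademacher_variable.
Local Open Scope ereal_scope.
Context {dT : measure_display} {T : measurableType dT} {R : realType}.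
Context (P : probability T R) (X : T -> R).
Hypothesis mX : measurable_fun [set: T] X.
Hypothesis X1 : P (X @^-1` [set 1%R]) = (1 / 2)%:E.
Hypothesis XN1 : P (X @^-1` [set (-1)%R]) = (1 / 2)%:E.

Let mXpre (B : set R) : measurable B -> measurable (X @^-1` B).
Proof. by move=> mB; rewrite -[X in measurable X]setTI; exact: mX. Qed.

(** Only two masses are prescribed; they belong to disjoint events and add up to 1, so other values
    occur on a null set. Hence [h (X w)] agrees almost everywhere with a combination of two
    indicators, which carries both integrability and expectation. *)
Let AB : {ae P, forall w, X w = 1%R \/ X w = (-1)%R}.
Proof.
set A := X @^-1` [set 1%R]; set B := X @^-1` [set (-1)%R].
have mA : measurable A by exact: mXpre.
have mB : measurable B by exact: mXpre.
exists (~` (A `|` B)); split; first exact/measurableC/measurableU.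
  have AB0 : A `&` B = set0.
    by apply/seteqP; split => w //=; rewrite /A /B /= => -[-> ]; lra.
  have PAB : P (A `|` B) = 1.
    transitivity (P A + P B); first exact: measureU.
    by rewrite X1 XN1 -EFinD; congr EFin; lra.
  by rewrite probability_setC ?PAB ?subee//; exact: measurableU.
by move=> w /= h [a|b]; apply: h; [left|right].
Qed.

Let hX (h : R -> R) : {ae P, forall w, [set: T] w ->
  (h (X w))%:E = (h 1 * \1_(X @^-1` [set 1%R]) w + h (-1) * \1_(X @^-1` [set (-1)%R]) w)%:E}.
Proof.
case: AB => N [mN N0 sub]; exists N; split => // w /= hw; apply: sub => /= hor.
apply: hw => _; congr EFin; rewrite !indicE.
have [Xw|Xw] := hor.
- by rewrite (mem_set (A := X @^-1` [set 1%R]))// memNset /= ?Xw ?mulr1 ?mulr0 ?addr0//; lra.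
- rewrite (mem_set (A := X @^-1` [set (-1)%R]))// memNset /= ?Xw ?mulr1 ?mulr0 ?add0r//; lra.
Qed.

Let int_rhs (h : R -> R) : P.-integrable [set: T] (fun w =>
  (h 1 * \1_(X @^-1` [set 1%R]) w + h (-1) * \1_(X @^-1` [set (-1)%R]) w)%:E).
Proof.
under eq_fun do rewrite EFinD !EFinM.
by apply: integrableD => //; apply: integrableZl => //; apply: integrable_indic => //; exact: mXpre.
Qed.

Lemma integrable_rademacher (h : R -> R) : measurable_fun [set: R] h ->
  P.-integrable [set: T] (fun w => (h (X w))%:E).
Proof.
move=> mh.
have mhX : measurable_fun [set: T] (fun w => (h (X w))%:E).
  by apply/measurable_EFinP; exact: (measurableT_comp mh mX).
apply/integrableP; split => //.
have /integrableP[mr] := int_rhs h; apply: le_lt_trans.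
apply: ae_ge0_le_integral => //; do ?exact: measurableT_comp.
case: (hX h) => N [mN N0 sub]; exists N; split => // w hw; apply: sub => /= e.
by apply: hw => Dw; rewrite (e Dw).
Qed.

Lemma Rintegral_rademacher (h : R -> R) : measurable_fun [set: R] h ->
  (\int[P]_w h (X w) = (h 1 + h (-1)) / 2)%R.
Proof.
move=> mh; rewrite /Rintegral.
have mhX : measurable_fun [set: T] (fun w => (h (X w))%:E).
  by apply/measurable_EFinP; exact: (measurableT_comp mh mX).
have /integrableP[mr _] := int_rhs h.
rewrite (ae_eq_integral _ _ measurableT mhX mr (hX h)).
under eq_integral do rewrite EFinD !EFinM.
have iI (B : set R) : measurable B ->
    P.-integrable [set: T] (fun w => (\1_(X @^-1` B) w)%:E).
  by move=> mB; apply: integrable_indic => //; exact: mXpre.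
rewrite integralD//; do ?by apply: integrableZl => //; exact: iI.
rewrite !integralZl//; do ?exact: iI.
rewrite !integral_indic ?setIT//; do ?exact: mXpre.
transitivity (fine ((h 1)%:E * (1 / 2)%:E + (h (-1))%:E * (1 / 2)%:E)); last by rewrite /=; lra.
by congr (fine (_ * _ + _ * _)); [exact: X1|exact: XN1].
Qed.

End rademacher_variable.

(** * Complex polynomials in independent variables *)

Section polynomials_in_random_variables.
Context {dT : measure_display} {T : measurableType dT} {R : realType}.
Context (P : probability T R) {I : finType} (Y : I -> T -> R).
Implicit Types (S : set I) (Z : T -> R[i]) (a : {ffun I -> nat}).

Definition cexpectation Z : R[i] :=
  Complex (\int[P]_w complex.Re (Z w)) (\int[P]_w complex.Im (Z w)).

Definition rmonomial a (w : T) : R := \prod_i Y i w ^+ a i.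

Definition cpoly_eval (s : seq (R[i] * {ffun I -> nat})) (w : T) : R[i] :=
  \sum_(p <- s) p.1 * (rmonomial p.2 w)%:C%C.

(* Explicit lists of monomials make the expectation of a product of polynomials in
   disjoint sets of variables factor with no grouping lemma for independence. *)
Definition cpoly S Z := exists s : seq (R[i] * {ffun I -> nat}),
  (forall p, p \in s -> forall i, p.2 i != 0%N -> S i) /\
  Z = cpoly_eval s.

Lemma cpolyW S S' Z : S `<=` S' -> cpoly S Z -> cpoly S' Z.
Proof. by move=> SS' [s [hs ->]]; exists s; split => // p ps i /(hs p ps) /SS'. Qed.

Lemma cpoly_cst S c : cpoly S (fun=> c).
Proof.
exists [:: (c, [ffun=> 0%N])]; split.
  by move=> p; rewrite inE => /eqP -> i /=; rewrite ffunE.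
apply/funext => w; rewrite /cpoly_eval big_seq1 /rmonomial big1 ?mulr1// => i _.
by rewrite ffunE expr0.
Qed.

Lemma cpoly_var S i : S i -> cpoly S (fun w => (Y i w)%:C%C).
Proof.
move=> Si; exists [:: (1, [ffun j => (j == i) : nat])]; split.
  by move=> p; rewrite inE => /eqP -> j /=; rewrite ffunE; have [->|] := eqVneq j i.
apply/funext => w; rewrite /cpoly_eval big_seq1 mul1r /rmonomial (bigD1 i)//=.
rewrite ffunE eqxx expr1 big1 ?mulr1// => j /negbTE ji.
by rewrite ffunE ji expr0.
Qed.

Lemma cpolyD S Z Z' : cpoly S Z -> cpoly S Z' -> cpoly S (fun w => Z w + Z' w).
Proof.
move=> [s [hs ->]] [s' [hs' ->]]; exists (s ++ s'); split.
  by move=> p; rewrite mem_cat => /orP[]; [exact: hs|exact: hs'].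
by apply/funext => w; rewrite /cpoly_eval big_cat.
Qed.

Let mulp (p q : R[i] * {ffun I -> nat}) : R[i] * {ffun I -> nat} :=
  (p.1 * q.1, [ffun i => (p.2 i + q.2 i)%N]).

Let cpoly_evalM s s' w : cpoly_eval s w * cpoly_eval s' w =
  cpoly_eval [seq mulp p q | p <- s, q <- s'] w.
Proof.
rewrite /cpoly_eval big_allpairs_dep mulr_suml; apply: eq_bigr => p _.
rewrite mulr_sumr; apply: eq_bigr => q _ /=.
rewrite mulrACA; congr (_ * _); rewrite -rmorphM/= /rmonomial -big_split; congr (_%:C%C).
by apply: eq_bigr => i _; rewrite ffunE exprD.
Qed.

Lemma cpolyM S Z Z' : cpoly S Z -> cpoly S Z' -> cpoly S (fun w => Z w * Z' w).
Proof.
move=> [s [hs ->]] [s' [hs' ->]]; exists [seq mulp p q | p <- s, q <- s']; split.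
  move=> p /allpairsP[[p1 p2] /= [h1 h2 ->]] i /=; rewrite ffunE addn_eq0 negb_and.
  by move=> /orP[]; [exact: hs|exact: hs'].
by apply/funext => w; rewrite cpoly_evalM.
Qed.

Lemma cpolyZ S c Z : cpoly S Z -> cpoly S (fun w => c * Z w).
Proof. by apply: cpolyM; exact: cpoly_cst. Qed.

Lemma cpolyB S Z Z' : cpoly S Z -> cpoly S Z' -> cpoly S (fun w => Z w - Z' w).
Proof.
move=> pZ pZ'; apply: cpolyD => //.
by under eq_fun do rewrite -mulN1r; exact: cpolyZ.
Qed.

Lemma cpoly_conj S Z : cpoly S Z -> cpoly S (fun w => conjc (Z w)).
Proof.
move=> [s [hs ->]]; exists [seq (conjc p.1, p.2) | p <- s]; split.
  by move=> p /mapP[q qs ->] i /=; exact: hs.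
apply/funext => w; rewrite /cpoly_eval big_map rmorph_sum/=; apply: eq_bigr => p _.
by rewrite rmorphM; congr (_ * _); exact: conjc_real.
Qed.

Lemma cpoly_sum S (J : Type) (r : seq J) (Z : J -> T -> R[i]) :
  (forall j, cpoly S (Z j)) -> cpoly S (fun w => \sum_(j <- r) Z j w).
Proof.
move=> pZ; elim: r => [|j r IH].
  by under eq_fun do rewrite big_nil; exact: cpoly_cst.
by under eq_fun do rewrite big_cons; exact: cpolyD.
Qed.

Lemma cpoly_prod S (J : eqType) (r : seq J) (Z : J -> T -> R[i]) :
  (forall j, j \in r -> cpoly S (Z j)) -> cpoly S (fun w => \prod_(j <- r) Z j w).
Proof.
elim: r => [_|j r IH pZ].
  by under eq_fun do rewrite big_nil; exact: cpoly_cst.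
under eq_fun do rewrite big_cons; apply: cpolyM; first by apply: pZ; rewrite mem_head.
by apply: IH => k kr; apply: pZ; rewrite inE kr orbT.
Qed.

Hypothesis mY : forall i, measurable_fun [set: T] (Y i).
Hypothesis indepY : forall B : I -> set R, (forall i, measurable (B i)) ->
  P (\bigcap_i (Y i @^-1` B i)) = (\prod_i P (Y i @^-1` B i))%E.
Hypothesis intY : forall i n, P.-integrable [set: T] (fun w => (Y i w ^+ n)%:E).

Let moment a : R := \prod_i \int[P]_w (Y i w ^+ a i).

Let mX n : measurable_fun [set: R] (fun x : R => x ^+ n).
Proof. exact: measurable_funX. Qed.

Let integrable_rmonomial a : P.-integrable [set: T] (fun w => (rmonomial a w)%:E).
Proof. exact: (integrable_prod_indep mY indepY (f := fun i x => x ^+ a i)). Qed.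

Let Rintegral_rmonomial a : \int[P]_w rmonomial a w = moment a.
Proof. exact: (Rintegral_prod_indep mY indepY (f := fun i x => x ^+ a i)). Qed.

Let Re_cpoly s w : complex.Re (cpoly_eval s w) =
  \sum_(p <- s) complex.Re p.1 * rmonomial p.2 w.
Proof.
rewrite /cpoly_eval raddf_sum; apply: eq_bigr => p _.
by case: p.1 => x y /=; rewrite mulr0 subr0.
Qed.

Let Im_cpoly s w : complex.Im (cpoly_eval s w) =
  \sum_(p <- s) complex.Im p.1 * rmonomial p.2 w.
Proof.
rewrite /cpoly_eval raddf_sum; apply: eq_bigr => p _.
by case: p.1 => x y /=; rewrite mulr0 add0r.
Qed.

Let integrable_rpoly (c : R[i] -> R) (s : seq (R[i] * {ffun I -> nat})) :
  P.-integrable [set: T] (fun w => (\sum_(p <- s) c p.1 * rmonomial p.2 w)%:E).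
Proof.
have -> : (fun w => (\sum_(p <- s) c p.1 * rmonomial p.2 w)%:E) =
  (fun w => \sum_(p <- s) (c p.1)%:E * (rmonomial p.2 w)%:E)%E.
  by apply/funext => w; rewrite sumEFin.
by apply: integrable_sum => // p _; exact: integrableZl.
Qed.

Let Rintegral_rpoly (c : R[i] -> R) (s : seq (R[i] * {ffun I -> nat})) :
  \int[P]_w (\sum_(p <- s) c p.1 * rmonomial p.2 w) = \sum_(p <- s) c p.1 * moment p.2.
Proof.
rewrite Rintegral_sum.
  by apply: eq_bigr => p _; rewrite RintegralZl ?Rintegral_rmonomial//; exact: integrable_rmonomial.
by move=> p; under eq_fun do rewrite EFinM; exact: integrableZl.
Qed.

Lemma integrable_Re_cpoly S Z : cpoly S Z ->
  P.-integrable [set: T] (fun w => (complex.Re (Z w))%:E).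
Proof. by move=> [s [_ ->]]; under eq_fun do rewrite Re_cpoly; exact: integrable_rpoly. Qed.

Lemma integrable_Im_cpoly S Z : cpoly S Z ->
  P.-integrable [set: T] (fun w => (complex.Im (Z w))%:E).
Proof. by move=> [s [_ ->]]; under eq_fun do rewrite Im_cpoly; exact: integrable_rpoly. Qed.

Let cexpectationE s : cexpectation (cpoly_eval s) =
  \sum_(p <- s) p.1 * (moment p.2)%:C%C.
Proof.
rewrite /cexpectation.
under eq_Rintegral do rewrite Re_cpoly.
under [X in Complex _ X]eq_Rintegral do rewrite Im_cpoly.
rewrite (Rintegral_rpoly (@complex.Re R)) (Rintegral_rpoly (@complex.Im R)).
apply/eqP; rewrite eq_complex !raddf_sum/=; apply/andP; split; apply/eqP/eq_bigr => p _.
  by case: p.1 => x y /=; rewrite mulr0 subr0.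
by case: p.1 => x y /=; rewrite mulr0 add0r.
Qed.

Let RintegralC (r : R) : \int[P]_w r = r.
Proof. by have := expectation_cst P r; rewrite unlock /Rintegral => ->. Qed.

Lemma cexpectation_cst c : cexpectation (fun=> c) = c.
Proof.
by rewrite /cexpectation !RintegralC; case: c.
Qed.

Lemma cexpectationD S Z Z' : cpoly S Z -> cpoly S Z' ->
  cexpectation (fun w => Z w + Z' w) = cexpectation Z + cexpectation Z'.
Proof.
move=> [s [_ ->]] [s' [_ ->]]; rewrite !cexpectationE -big_cat -cexpectationE.
by congr cexpectation; apply/funext => w; rewrite /cpoly_eval big_cat.
Qed.

Lemma cexpectation_indepM S S' Z Z' : cpoly S Z -> cpoly S' Z' -> S `&` S' = set0 ->
  cexpectation (fun w => Z w * Z' w) = cexpectation Z * cexpectation Z'.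
Proof.
move=> [s [hs ->]] [s' [hs' ->]] SS'.
under eq_fun do rewrite cpoly_evalM.
rewrite !cexpectationE big_allpairs_dep mulr_suml !big_seq; apply: eq_bigr => p ps.
rewrite mulr_sumr !big_seq; apply: eq_bigr => q qs /=.
rewrite mulrACA; congr (_ * _); rewrite -rmorphM/= /moment -big_split; congr (_%:C%C).
apply: eq_bigr => i _; rewrite /= ffunE.
(* Since [S] and [S'] are disjoint, at each variable at most one of the two exponents is nonzero;
   the other factor is a moment of order 0, equal to 1. *)
have m0 : \int[P]_w (Y i w ^+ 0) = 1.
  by under eq_Rintegral do rewrite expr0; exact: RintegralC.
have [->|pi0] := eqVneq (p.2 i) 0%N; first by rewrite add0n m0 mul1r.
have [->|qi0] := eqVneq (q.2 i) 0%N; first by rewrite addn0 m0 mulr1.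
by have : (S `&` S') i by [split; [exact: hs pi0|exact: hs' qi0]]; rewrite SS'.
Qed.

Lemma cexpectationZ S c Z : cpoly S Z ->
  cexpectation (fun w => c * Z w) = c * cexpectation Z.
Proof.
move=> pZ; rewrite (cexpectation_indepM (cpoly_cst set0 c) pZ) ?set0I//.
by rewrite cexpectation_cst.
Qed.

Lemma cexpectationB S Z Z' : cpoly S Z -> cpoly S Z' ->
  cexpectation (fun w => Z w - Z' w) = cexpectation Z - cexpectation Z'.
Proof.
move=> pZ pZ'; under eq_fun do rewrite -mulN1r.
by rewrite (cexpectationD pZ (cpolyZ _ pZ')) (cexpectationZ _ pZ') mulN1r.
Qed.

Lemma cexpectation_sum S (J : Type) (r : seq J) (Z : J -> T -> R[i]) :
  (forall j, cpoly S (Z j)) ->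
  cexpectation (fun w => \sum_(j <- r) Z j w) = \sum_(j <- r) cexpectation (Z j).
Proof.
move=> pZ; elim: r => [|j r IH].
  by under eq_fun do rewrite big_nil; rewrite cexpectation_cst big_nil.
under eq_fun do rewrite big_cons.
by rewrite (cexpectationD (pZ j) (cpoly_sum r pZ)) IH big_cons.
Qed.

Lemma cexpectation_prod (J : eqType) (r : seq J) (S : J -> set I) (Z : J -> T -> R[i]) :
  uniq r -> (forall j, cpoly (S j) (Z j)) ->
  (forall j j' i, S j i -> S j' i -> j = j') ->
  cexpectation (fun w => \prod_(j <- r) Z j w) = \prod_(j <- r) cexpectation (Z j).
Proof.
move=> ur pZ dS; elim: r ur => [_|j r IH /= /andP[jr ur]].
  by under eq_fun do rewrite big_nil; rewrite cexpectation_cst big_nil.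
under eq_fun do rewrite big_cons.
rewrite big_cons -IH//.
have pr : cpoly (fun i => exists2 k, k \in r & S k i) (fun w => \prod_(j <- r) Z j w).
  apply: cpoly_prod => k kr; apply: cpolyW (pZ k) => i Ski.
  by exists k.
rewrite (cexpectation_indepM (pZ j) pr)//.
apply/seteqP; split=> i //= -[Sji [k kr Ski]].
by move: jr; rewrite (dS _ _ _ Sji Ski) kr.
Qed.

End polynomials_in_random_variables.

(** * Probability estimates *)

Section good_event.
Context {dT : measure_display} {T : measurableType dT} {R : realType}.
Variable P : probability T R.

Lemma markov_Rintegral (X : T -> R) (t : R) :
  P.-integrable [set: T] (fun w => (X w)%:E) -> (forall w, 0 <= X w) -> 0 < t ->
  (P [set w | t <= X w]%R <= (\int[P]_w X w / t)%:E)%E.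
Proof.
move=> intX X0 t0; have /integrableP[/measurable_EFinP mX _] := intX.
rewrite EFinM muleC -lee_pdivrMl ?invr_gt0// invrK muleC.
have mXE : measurable_fun [set: T] (EFin \o X) by exact/measurable_EFinP.
have := le_integral_abse P measurableT mXE t0; rewrite setTI /=.
have -> : [set x | (t%:E <= `|X x|%:E)%E] = [set w | t <= X w].
  by apply/seteqP; split=> w /=; rewrite lee_fin ger0_norm.
rewrite muleC => /le_trans; apply.
rewrite /Rintegral fineK; last exact: integrable_fin_num.
by rewrite le_eqVlt; apply/orP; left; apply/eqP/eq_integral => w _; rewrite ger0_norm.
Qed.

(** The bad events [tau < a] and [K * a ^+ 2 <= X] have probability at most 1/8 each, the second by
    Markov; outside both, [X < K * a ^+ 2 <= K * tau ^+ 2]. Both claims are instances with [tau] the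
    trace: [X] is the variance given [g] in (i), and the squared error with [K = eps ^+ 2] in
    (ii). *)
Lemma good_event_ge (X tau : T -> R) (m K a : R) :
  P.-integrable [set: T] (fun w => (X w)%:E) -> measurable_fun [set: T] tau ->
  (forall w, 0 <= X w) -> (forall w, 0 <= tau w) ->
  \int[P]_w X w <= m -> (P [set w | tau w < a]%R <= (1 / 8)%:E)%E ->
  0 < K -> 0 < a -> 8 * m <= K * a ^+ 2 ->
  ((3 / 4)%:E <= P [set w | X w <= K * tau w ^+ 2]%R)%E.
Proof.
move=> intX mtau X0 tau0 mX Pa K0 a0 mKa.
have /integrableP[/measurable_EFinP mXf _] := intX.
have Ka0 : 0 < K * a ^+ 2 by rewrite mulr_gt0// exprn_gt0.
set G := [set w | X w <= K * tau w ^+ 2]%R.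
set A := [set w | tau w < a]%R; set B := [set w | K * a ^+ 2 <= X w]%R.
have mA : measurable A.
  have -> : A = ~` ([set: T] `&` [set w | a <= tau w]).
    by rewrite setTI; apply/seteqP; split => w; rewrite /A/= ltNge => /negP.
  by apply/measurableC/measurable_fun_le.
have mB : measurable B by rewrite -[B]setTI; exact: measurable_fun_le.
have mG : measurable G.
  rewrite -[G]setTI; apply: measurable_fun_le => //.
  by apply: measurable_funM => //; exact: measurable_funX.
have PB : (P B <= (1 / 8)%:E)%E.
  apply: le_trans (markov_Rintegral intX X0 Ka0) _.
  by rewrite lee_fin ler_pdivrMr//; lra.
have sub : ~` G `<=` A `|` B.
  move=> w /negP; rewrite -ltNge => Gw; have [|ta] := ltP (tau w) a; first by left.
  right; apply: le_trans (ltW Gw).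
  by rewrite ler_pM2l// ler_pXn2r// ?nnegrE// ltW.
have : (P (~` G) <= (1 / 8)%:E + (1 / 8)%:E)%E.
  apply: (@le_trans _ _ (P (A `|` B))).
    by apply: le_measure => //; rewrite inE; [exact: measurableC|exact: measurableU].
  apply: le_trans (measureU2 _ _ _) _ => //; exact: leeD.
rewrite probability_setC//.
have : P G \is a fin_num by exact: fin_num_measure.
by case: (P G) => // r _; rewrite -EFinB -EFinD !lee_fin; lra.
Qed.

End good_event.

Lemma sqr_norm_small_ball {dT : measure_display} {T : measurableType dT} {R : realType}
    (P : probability T R) (U : finType) (g : U -> T -> R) :
  (forall u, measurable_fun [set: T] (g u)) ->
  (forall u (B : set R), measurable B -> P (g u @^-1` B) = normal_prob 0 1 B) ->
  (0 < #|U|)%N ->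
  (P [set w | \sum_u g u w ^+ 2 < #|U|%:R / 2048]%R <= (1 / 8)%:E)%E.
Proof.
(* Markov's inequality for the number of coordinates of absolute value at most 1/32. *)
move=> mg lawg U0; set n : R := #|U|%:R.
have n0 : 0 < n by rewrite ltr0n.
pose A u := [set w | `|g u w| <= 32^-1]%R.
have mA u : measurable (A u).
  have -> : A u = g u @^-1` `[- 32^-1, 32^-1]%classic.
    by apply/seteqP; split=> w /=; rewrite /A/= in_itv/= ler_norml.
  by rewrite -[X in measurable X]setTI; exact: mg.
have intA u : P.-integrable [set: T] (fun w => (\1_(A u) w)%:E) by exact: integrable_indic.
pose N w : R := \sum_u \1_(A u) w.
have intN : P.-integrable [set: T] (fun w => (N w)%:E).
  rewrite /N; under eq_fun do rewrite -sumEFin.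
  exact: integrable_sum.
have N0 w : 0 <= N w by apply: sumr_ge0 => u _; rewrite indicE.
have EN : \int[P]_w N w <= n / 16.
  rewrite Rintegral_sum//.
  apply: (@le_trans _ _ (\sum_(u : U) 16^-1)); last first.
    by rewrite sumr_const -[leLHS]mulr_natl.
  apply: ler_sum => u _; rewrite /Rintegral integral_indic// setIT.
  have h : (P (A u) <= (16^-1)%:E)%E.
    have s0 : (0 <= 32^-1 :> R)%R by rewrite invr_ge0.
    apply: (le_trans (normal_small_ball (lawg u) s0)).
    by rewrite lee_fin; lra.
  rewrite -lee_fin fineK//; exact: fin_num_measure.
have n2 : 0 < n / 2 by rewrite divr_gt0.
have M := markov_Rintegral intN N0 n2.
apply: (@le_trans _ _ (P [set w | n / 2 <= N w]%R)); last first.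
  by apply: le_trans M _; rewrite lee_fin ler_pdivrMr//; lra.
have mN : measurable_fun [set: T] N.
  by have /integrableP[/measurable_EFinP] := intN.
apply: le_measure; rewrite ?inE.
- have -> : [set w | \sum_u g u w ^+ 2 < n / 2048] =
      ~` ([set: T] `&` [set w | n / 2048 <= \sum_u g u w ^+ 2]).
    by rewrite setTI; apply/seteqP; split => w; rewrite /= ltNge => /negP.
  apply/measurableC/measurable_fun_le => //.
  by apply: measurable_sum => u; exact: measurable_funX.
- by rewrite -[X in measurable X]setTI; exact: measurable_fun_le.
- move=> w /= h.
  (* A coordinate outside [A u] contributes at least [32^-2], and [n / 2048] equals
     [32^-2 * (n / 2)]: a smaller sum forces at least half of the coordinates into the small
     ball. *)
  have : 32^-1 ^+ 2 * (n - N w) <= \sum_u g u w ^+ 2.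
    have -> : n = \sum_(u : U) 1 by rewrite sumr_const.
    rewrite -sumrB mulr_sumr; apply: ler_sum => u _.
    rewrite indicE; case: (boolP (w \in A u)) => [_|].
      by rewrite subrr mulr0 sqr_ge0.
    rewrite notin_setE /A/= => /negP; rewrite -ltNge => gu.
    by rewrite subr0 mulr1 -(real_normK (num_real (g u w))) ler_pXn2r// ?nnegrE// ltW.
  lra.
Qed.

(** * Second moment of the estimator *)

Section model_moments.
Context {dT : measure_display} {T : measurableType dT} (P : probability T Rl).
Context {d k l : nat} (Y : kh_index d k l -> T -> Rl).
Hypothesis mY : forall i, measurable_fun [set: T] (Y i : T -> RM).
Hypothesis indepY : mutually_independent P Y.
Hypothesis intY : forall i n, P.-integrable [set: T] (fun w => (Y i w ^+ n)%:E).
Hypothesis Y1 : forall i, \int[P]_w Y i w = 0.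
Hypothesis Y2 : forall i, \int[P]_w (Y i w ^+ 2) = 1.
Hypothesis Y4 : forall i, \int[P]_w (Y i w ^+ 4) <= 3.
Hypothesis Y4g : forall u, \int[P]_w (Y (inl u) w ^+ 4) = 3.

Local Notation E := (cexpectation P).
Let EM := cexpectation_indepM mY indepY intY.
Let EC := cexpectation_cst P.
Let ED := cexpectationD mY indepY intY.
Let EB := cexpectationB mY indepY intY.
Let EZ := cexpectationZ mY indepY intY.
Let Esum := cexpectation_sum mY indepY intY.
Let Eprod := cexpectation_prod mY indepY intY.

Let yv i w : Rl[i] := (Y i w)%:C%C.

Let pv i : cpoly Y [set i] (yv i).
Proof. exact: cpoly_var. Qed.

Let pvX i n : cpoly Y [set i] (fun w => yv i w ^+ n).
Proof.
elim: n => [|n IH]; first by under eq_fun do rewrite expr0; exact: cpoly_cst.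
by under eq_fun do rewrite exprS; exact: cpolyM.
Qed.

Let E_vX i n : E (fun w => yv i w ^+ n) = (\int[P]_w (Y i w ^+ n))%:C%C.
Proof.
rewrite /cexpectation /yv; under eq_Rintegral do rewrite -rmorphXn/=.
under [X in Complex _ X]eq_Rintegral do rewrite -rmorphXn/=.
by congr Complex; rewrite /Rintegral integral0.
Qed.

Let E_v i : E (yv i) = 0.
Proof. by have := E_vX i 1; under eq_fun do rewrite expr1; rewrite [X in X%:C%C]Y1. Qed.

Let E_v2 i : E (fun w => yv i w ^+ 2) = 1.
Proof. by rewrite E_vX Y2. Qed.

(** * Moments of the entries of one factor *)

Let xi c j a w := xfac Y c j a w.

Definition xset (c : 'I_l) (j : 'I_k) (a : 'I_d) : set (kh_index d k l) :=
  [set i | exists b, i = inr (c, j, a, b)].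

Let vr c j a := yv (inr (c, j, a, true)).
Let vi c j a := yv (inr (c, j, a, false)).

Let xiE c j a w : xi c j a w = ((Num.sqrt 2)^-1)%:C%C * (vr c j a w + 'i%C * vi c j a w).
Proof.
rewrite /xi /xfac /vr /vi /yv; apply/eqP; rewrite eq_complex /=; apply/andP; split; apply/eqP; ring.
Qed.

Let xif c j a :
  xi c j a = fun w => ((Num.sqrt 2)^-1)%:C%C * (vr c j a w + 'i%C * vi c j a w).
Proof. by apply/funext => w; exact: xiE. Qed.

Let xiJE c j a w : conjc (xi c j a w) =
  ((Num.sqrt 2)^-1)%:C%C * (vr c j a w - 'i%C * vi c j a w).
Proof.
rewrite /xi /xfac /vr /vi /yv; apply/eqP; rewrite eq_complex /=; apply/andP; split; apply/eqP; ring.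
Qed.

Let invsqrt2_sqr : (((Num.sqrt 2)^-1)%:C%C : Rl[i]) ^+ 2 = (2^-1)%:C%C.
Proof. by rewrite -rmorphXn/= exprVn sqr_sqrtr. Qed.

Let i2 : ('i%C : Rl[i]) ^+ 2 = -1.
Proof. exact: sqr_i. Qed.

Let xi2E c j a w : xi c j a w ^+ 2 =
  (2^-1)%:C%C * ((vr c j a w ^+ 2 - vi c j a w ^+ 2) + 'i%C *+ 2 * (vr c j a w * vi c j a w)).
Proof. by rewrite xiE exprMn invsqrt2_sqr; congr (_ * _); ring: i2. Qed.

Let xinormE c j a w : conjc (xi c j a w) * xi c j a w =
  (2^-1)%:C%C * (vr c j a w ^+ 2 + vi c j a w ^+ 2).
Proof. by rewrite xiJE xiE mulrACA -expr2 invsqrt2_sqr; congr (_ * _); ring: i2. Qed.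

Let xinorm2E c j a w : (conjc (xi c j a w) * xi c j a w) ^+ 2 =
  (4^-1)%:C%C * (vr c j a w ^+ 4 + 2 * (vr c j a w ^+ 2 * vi c j a w ^+ 2) + vi c j a w ^+ 4).
Proof.
rewrite xinormE exprMn -rmorphXn/= exprVn -natrX; congr (_ * _); ring.
Qed.

Let disj (i i' : kh_index d k l) : i != i' -> [set i] `&` [set i'] = set0.
Proof. by move=> ii'; apply/seteqP; split => x //= [-> e]; rewrite e eqxx in ii'. Qed.

Let disjri c j a :
  [set (inr (c, j, a, true) : kh_index d k l)] `&` [set inr (c, j, a, false)] = set0.
Proof. by apply: disj; apply/eqP => -[]. Qed.

Let xr c j a n : cpoly Y (xset c j a) (fun w => vr c j a w ^+ n).
Proof. by apply: cpolyW (pvX _ n) => i /= ->; exists true. Qed.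

Let xm c j a n : cpoly Y (xset c j a) (fun w => vi c j a w ^+ n).
Proof. by apply: cpolyW (pvX _ n) => i /= ->; exists false. Qed.

Let pxi c j a : cpoly Y (xset c j a) (xi c j a).
Proof.
rewrite xif; apply: cpolyZ; apply: cpolyD; first exact: (xr _ _ _ 1).
by apply: cpolyZ; exact: (xm _ _ _ 1).
Qed.

Let E_xi c j a : E (xi c j a) = 0.
Proof.
rewrite xif (EZ _ (S := xset c j a)); last first.
  by apply: cpolyD; [exact: (xr _ _ _ 1)|apply: cpolyZ; exact: (xm _ _ _ 1)].
rewrite (ED (xr c j a 1) (cpolyZ _ (xm c j a 1))) (EZ _ (xm c j a 1)).
by rewrite !E_v mulr0 addr0 mulr0.
Qed.

(** Real and imaginary parts have equal variance, so their squares cancel in the mean; the cross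
    term vanishes by independence. *)
Let E_xi2 c j a : E (fun w => xi c j a w ^+ 2) = 0.
Proof.
under eq_fun do rewrite xi2E.
have p1 := cpolyB (xr c j a 2) (xm c j a 2).
have p2 := cpolyM (xr c j a 1) (xm c j a 1).
rewrite (EZ _ (cpolyD p1 (cpolyZ _ p2))) (ED p1 (cpolyZ _ p2)) (EZ _ p2).
rewrite (EB (xr c j a 2) (xm c j a 2)) !E_v2 (EM (pv _) (pv _) (disjri c j a)) !E_v.
by rewrite subrr mul0r mulr0 addr0 mulr0.
Qed.

Let E_xinorm c j a : E (fun w => conjc (xi c j a w) * xi c j a w) = 1.
Proof.
under eq_fun do rewrite xinormE.
rewrite (EZ _ (cpolyD (xr c j a 2) (xm c j a 2))) (ED (xr c j a 2) (xm c j a 2)) !E_v2.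
by rewrite -(rmorph1 (real_complex Rl)) -rmorphD -rmorphM mulVf.
Qed.

(** With [r] and [m] the two real variables of the entry, [E |x_a|^4 = (E r^4 + 2 + E m^4) / 4 <= (3
    + 2 + 3) / 4]. The order on [Rl[i]] compares real parts and requires equal imaginary parts, so
    bounds of this kind also record that the quantities are real. *)
Let E_xinorm2 c j a : 0 <= E (fun w => (conjc (xi c j a w) * xi c j a w) ^+ 2) <= 2.
Proof.
under eq_fun do rewrite xinorm2E.
have p := cpolyM (xr c j a 2) (xm c j a 2).
have q := cpolyD (xr c j a 4) (cpolyZ 2 p).
rewrite (EZ _ (cpolyD q (xm c j a 4))) (ED q (xm c j a 4)) (ED (xr c j a 4) (cpolyZ 2 p)).
rewrite (EZ _ p) (EM (pvX _ 2) (pvX _ 2) (disjri c j a)) !E_v2 !E_vX !mulr1.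
have Y40 i : 0 <= \int[P]_w (Y i w ^+ 4) by apply: Rintegral_ge0 => w _; exact: exprn_even_ge0.
have -> : (2 : Rl[i]) = (2 : Rl)%:C%C by rewrite rmorph_nat.
rewrite -!rmorphD -rmorphM !lecR.
have := Y40 (inr (c, j, a, true)); have := Y40 (inr (c, j, a, false)).
have := Y4 (inr (c, j, a, true)); have := Y4 (inr (c, j, a, false)).
by lra.
Qed.

Let xset_disj c j a b : a != b -> xset c j a `&` xset c j b = set0.
Proof. by move=> ab; apply/seteqP; split=> i //= [[x ->] [y [e _]]]; rewrite e eqxx in ab. Qed.

Let E_xixi c j a b : E (fun w => conjc (xi c j a w) * xi c j b w) = (a == b)%:R.
Proof.
have [->|ab] := eqVneq a b; first exact: E_xinorm.
by rewrite (EM (cpoly_conj (pxi c j a)) (pxi c j b) (xset_disj _ _ ab)) E_xi mulr0.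
Qed.

Let N c j a w : Rl[i] := conjc (xi c j a w) * xi c j a w.

Let pN c j a : cpoly Y (xset c j a) (N c j a).
Proof. by apply: cpolyM => //; exact: cpoly_conj. Qed.

(** The one-leg factors of the second moments of [x]: [q] arises when the indices pair into
    [|x_a|^2 * |x_b|^2], and [q'] when the squares of [conj x_a] and [x_b] remain. For [a != b] the
    latter vanishes, because [E x_b^2 = 0]. *)
Let q c j a b := E (fun w => N c j a w * N c j b w).
Let q' c j a b := E (fun w => conjc (xi c j a w) ^+ 2 * xi c j b w ^+ 2).

Let q_bound c j a b : 0 <= q c j a b <= 1 + (a == b)%:R.
Proof.
rewrite /q; have [->|ab] := eqVneq a b.
  rewrite -[1 + true%:R]/(2 : Rl[i]).
  by under eq_fun do rewrite -expr2; exact: E_xinorm2.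
rewrite (EM (pN c j a) (pN c j b) (xset_disj _ _ ab)) !E_xinorm mulr1 addr0.
by rewrite ler01 lexx.
Qed.

Let q'_bound c j a b : 0 <= q' c j a b <= 1 + (a == b)%:R.
Proof.
rewrite /q'; have [->|ab] := eqVneq a b.
  rewrite -[1 + true%:R]/(2 : Rl[i]).
  by under eq_fun do rewrite -exprMn; exact: E_xinorm2.
have p c' j' a' : cpoly Y (xset c' j' a') (fun w => xi c' j' a' w ^+ 2).
  by under eq_fun do rewrite expr2; exact: cpolyM.
have pJ c' j' a' : cpoly Y (xset c' j' a') (fun w => conjc (xi c' j' a' w) ^+ 2).
  by under eq_fun do rewrite -rmorphXn; exact: cpoly_conj.
rewrite (EM (pJ c j a) (p c j b) (xset_disj _ _ ab)) E_xi2 mulr0 addr0.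
by rewrite lexx ler01.
Qed.

Let xjset (c : 'I_l) (j : 'I_k) : set (kh_index d k l) :=
  [set i | exists a b, i = inr (c, j, a, b)].

Let xset_sub c j a : xset c j a `<=` xjset c j.
Proof. by move=> i [b ->]; exists a, b. Qed.

Let pxij c j a : cpoly Y (xjset c j) (xi c j a).
Proof. exact: cpolyW (@xset_sub c j a) (pxi c j a). Qed.

Let pxiJj c j a : cpoly Y (xjset c j) (fun w => conjc (xi c j a w)).
Proof. exact: cpoly_conj. Qed.

Let pxixi c j a b : cpoly Y (xjset c j) (fun w => conjc (xi c j a w) * xi c j b w).
Proof. by apply: cpolyM; [exact: pxiJj|exact: pxij]. Qed.

Let E_prod c (Z : 'I_k -> T -> Rl[i]) : (forall j, cpoly Y (xjset c j) (Z j)) ->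
  E (fun w => \prod_j Z j w) = \prod_j E (Z j).
Proof.
move=> pZ; apply: (Eprod (S := xjset c)) => //; first exact: index_enum_uniq.
by move=> j j' i [a [b ->]] [a' [b' []]].
Qed.

(** * The entries [conj (x u) * x v] and their covariances *)

Definition xouter c u v w : Rl[i] := conjc (xtens Y c w u) * xtens Y c w v.
Local Notation W := xouter.

Let WE c u v w : W c u v w = \prod_j (conjc (xi c j (u j) w) * xi c j (v j) w).
Proof. by rewrite /xouter /xtens rmorph_prod -big_split. Qed.

Let WJ c u v w : conjc (W c u v w) = W c v u w.
Proof. by rewrite /xouter rmorphM/= conjcK mulrC. Qed.

(** This isotropy of [x] makes the estimator unbiased. The legs are independent, and if [u] and [v]
    differ, they differ on some leg, whose mean is 0. *)
Let E_W c u v : E (W c u v) = (u == v)%:R.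
Proof.
have -> : W c u v = fun w => \prod_j (conjc (xi c j (u j) w) * xi c j (v j) w).
  by apply/funext => w; exact: WE.
rewrite (@E_prod c); last by move=> j; exact: pxixi.
under eq_bigr do rewrite E_xixi.
have [->|uv] := eqVneq u v; first by rewrite big1// => j _; rewrite eqxx.
have [j uvj] : exists j, u j != v j.
  apply/existsP; rewrite -negb_forall; apply: contra uv => /forallP h.
  by apply/eqP/ffunP => j; exact/eqP/h.
by rewrite (bigD1 j)//= (negbTE uvj) mul0r.
Qed.

Let H (u v : tidx d k) : Rl[i] := \prod_j (1 + (u j == v j)%:R).

(** This bound and the next two treat the three index pairings of the Wick formula. In the first
    two, every leg is a [q] once the four entries are reordered; in the third, the product is the
    square of [W c u v] and every leg is a [q']. *)
Let E_WW1 c u s : E (fun w => W c u u w * conjc (W c s s w)) <= H u s.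
Proof.
under eq_fun do rewrite WJ !WE -big_split.
rewrite (@E_prod c); last by move=> j; apply: cpolyM; exact: pxixi.
by apply: ler_prod => j _; exact: q_bound.
Qed.

Let E_WW2 c u v : E (fun w => W c u v w * conjc (W c u v w)) <= H u v.
Proof.
under eq_fun do rewrite WJ !WE -big_split.
rewrite (@E_prod c); last by move=> j; apply: cpolyM; exact: pxixi.
apply: ler_prod => j _.
have := q_bound c j (u j) (v j); rewrite /q.
rewrite (_ : (fun w => _) = fun w => conjc (xi c j (u j) w) * xi c j (v j) w *
  (conjc (xi c j (v j) w) * xi c j (u j) w)) //.
by apply/funext => w; rewrite /N; ring.
Qed.

Let E_WW3 c u v : E (fun w => W c u v w * conjc (W c v u w)) <= H u v.
Proof.
under eq_fun do rewrite WJ -expr2 WE -prodrXl.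
rewrite (@E_prod c); last first.
  by move=> j; under eq_fun do rewrite expr2; apply: cpolyM; exact: pxixi.
apply: ler_prod => j _; have := q'_bound c j (u j) (v j); rewrite /q'.
by under eq_fun do rewrite -exprMn.
Qed.

Definition centered c u v w : Rl[i] := xouter c u v w - (u == v)%:R.
Local Notation D := centered.

Definition xcset (c : 'I_l) : set (kh_index d k l) :=
  [set i | exists j a b, i = inr (c, j, a, b)].

Let pW c u v : cpoly Y (xcset c) (W c u v).
Proof.
have -> : W c u v = fun w => \prod_j (conjc (xi c j (u j) w) * xi c j (v j) w).
  by apply/funext => w; exact: WE.
apply: cpoly_prod => j _; apply: cpolyW (pxixi _ _ _ _) => i [a [b ->]].
by exists j, a, b.
Qed.

Let pD c u v : cpoly Y (xcset c) (D c u v).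
Proof. by apply: cpolyB; [exact: pW|exact: cpoly_cst]. Qed.

Lemma cexpectation_centered c u v : E (D c u v) = 0.
Proof.
have pC (x : Rl[i]) := cpoly_cst Y (xcset c) x.
by rewrite (EB (pW c u v) (pC _)) E_W EC subrr.
Qed.

Let F c u v s t := E (fun w => D c u v w * conjc (D c s t w)).

Let FE c u v s t :
  F c u v s t = E (fun w => W c u v w * conjc (W c s t w)) - (u == v)%:R * (s == t)%:R.
Proof.
have pC (x : Rl[i]) := cpoly_cst Y (xcset c) x.
have pW' := cpoly_conj (pW c s t).
rewrite /F.
have -> : (fun w => D c u v w * conjc (D c s t w)) =
    (fun w => (W c u v w * conjc (W c s t w) - (s == t)%:R * W c u v w)
      - ((u == v)%:R * conjc (W c s t w) - (u == v)%:R * (s == t)%:R)).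
  by apply/funext => w; rewrite /centered rmorphB/= rmorph_nat; ring.
have p1 := cpolyM (pW c u v) pW'.
have p2 := cpolyZ (s == t)%:R (pW c u v).
have p3 := cpolyZ (u == v)%:R pW'.
rewrite (EB (cpolyB p1 p2) (cpolyB p3 (pC _))) (EB p1 p2) (EB p3 (pC _)) (EZ _ (pW c u v)).
have EWJ : E (fun w => conjc (W c s t w)) = (s == t)%:R.
  by under eq_fun do rewrite WJ; rewrite E_W eq_sym.
by rewrite (EZ _ pW') EC E_W EWJ; ring.
Qed.

Let natr_ge0' (b : bool) : 0 <= b%:R :> Rl[i]. Proof. exact: ler0n. Qed.

(** Passing from second moments to covariances, here and in the next two bounds, only subtracts a
    product of Kronecker deltas, which is nonnegative. *)
Let F_le1 c u s : F c u u s s <= H u s.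
Proof. by rewrite FE (le_trans _ (E_WW1 c u s))// lerBlDr lerDl mulr_ge0. Qed.

Let F_le2 c u v : F c u v u v <= H u v.
Proof. by rewrite FE (le_trans _ (E_WW2 c u v))// lerBlDr lerDl mulr_ge0. Qed.

Let F_le3 c u v : F c u v v u <= H u v.
Proof. by rewrite FE (le_trans _ (E_WW3 c u v))// lerBlDr lerDl mulr_ge0. Qed.

Let sum_H : \sum_u \sum_v H u v = (((d ^ 2 + d) ^ k)%N)%:R.
Proof.
transitivity (\prod_(j < k) \sum_(a < d) \sum_(b < d) (1 + (a == b)%:R : Rl[i])).
  rewrite bigA_distr_bigA; apply: eq_bigr => u _.
  by rewrite bigA_distr_bigA.
rewrite (eq_bigr (fun=> ((d ^ 2 + d)%N)%:R)) ?prodr_const ?card_ord ?natrX// => j _.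
rewrite (eq_bigr (fun=> (d + 1)%N%:R)) => [|a _].
  by rewrite sumr_const card_ord -mulrnA mulnDl mul1n mulnn.
rewrite big_split/= sumr_const card_ord natrD; congr (_ + _).
by rewrite (bigD1 a)//= eqxx big1 ?addr0// => b /negbTE; rewrite eq_sym => ->.
Qed.

(** * Fourth moments of [g] *)

Let gam u := yv (inl u).

Definition gset : set (kh_index d k l) := [set i | exists u, i = inl u].

Let pgam (S : set (kh_index d k l)) u : S (inl u) -> cpoly Y S (gam u).
Proof. by move=> Su; apply: cpoly_var. Qed.

Let isolated u (Z : T -> Rl[i]) :
  cpoly Y [set i | exists2 v, v != u & i = inl v] Z -> E (fun w => gam u w * Z w) = 0.
Proof.
move=> pZ; rewrite (EM (pv (inl u)) pZ) ?E_v ?mul0r//.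
by apply/seteqP; split=> i //= [-> [v vu []]]; move/eqP: vu => /[swap] ->.
Qed.

Let pairs u v : u != v -> E (fun w => gam u w ^+ 2 * gam v w ^+ 2) = 1.
Proof.
move=> uv; rewrite (EM (pvX (inl u) 2) (pvX (inl v) 2)) ?E_v2 ?mulr1//.
by apply: disj; apply/eqP => -[/eqP]; rewrite (negbTE uv).
Qed.

Definition gprod u v s t w : Rl[i] := gam u w * gam v w * (gam s w * gam t w).

Let isolated3 u v s t : v != u -> s != u -> t != u ->
  E (fun w => gam u w * (gam v w * gam s w * gam t w)) = 0.
Proof.
move=> vu su tu; apply: isolated.
by do ?[apply: cpolyM]; apply: pgam; [exists v|exists s|exists t].
Qed.

(** Case analysis on coincidences among the indices. If all agree, the moment 3 counts the three
    pairings; two distinct pairs match exactly one pairing and give 1; every other pattern has an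
    index occurring once, and its zero mean kills the product. *)
Let E_gprod u v s t : E (gprod u v s t) =
  (u == v)%:R * (s == t)%:R + (u == s)%:R * (v == t)%:R + (u == t)%:R * (v == s)%:R.
Proof.
rewrite /gprod.
have [<-|uv] := eqVneq u v.
  have [<-|st] := eqVneq s t.
    have [<-|us] := eqVneq u s.
      rewrite (_ : (fun w => _) = fun w => yv (inl u) w ^+ 4); last first.
        by apply/funext => w; rewrite /gam; ring.
      by rewrite E_vX Y4g rmorph_nat ?eqxx /= ?mulr1n ?mulr0n; ring.
    rewrite (_ : (fun w => _) = fun w => gam u w ^+ 2 * gam s w ^+ 2); last first.
      by apply/funext => w; ring.
    by rewrite pairs// ?eqxx /= ?mulr1n ?mulr0n; ring.
  have [us|us] := eqVneq u s.
    rewrite (_ : (fun w => _) = fun w => gam t w * (gam u w * gam u w * gam s w)); last first.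
      by apply/funext => w; ring.
    have ut : u != t by rewrite us.
    by rewrite isolated3// (negbTE ut) ?eqxx /= ?mulr1n ?mulr0n; ring.
  rewrite (_ : (fun w => _) = fun w => gam s w * (gam u w * gam u w * gam t w)); last first.
    by apply/funext => w; ring.
  by rewrite isolated3// 1?eq_sym// ?eqxx /= ?mulr1n ?mulr0n; ring.
have [<-|us] := eqVneq u s.
  have [<-|vt] := eqVneq v t.
    rewrite (_ : (fun w => _) = fun w => gam u w ^+ 2 * gam v w ^+ 2); last first.
      by apply/funext => w; ring.
    by rewrite pairs// ?(eq_sym v) ?(negbTE uv) ?eqxx /= ?mulr1n ?mulr0n; ring.
  rewrite (_ : (fun w => _) = fun w => gam v w * (gam u w * gam u w * gam t w)); last first.
    by apply/funext => w; ring.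
  by rewrite isolated3// 1?eq_sym// ?(eq_sym v) ?(negbTE uv) ?eqxx /= ?mulr1n ?mulr0n; ring.
have [<-|ut] := eqVneq u t.
  have [<-|vs] := eqVneq v s.
    rewrite (_ : (fun w => _) = fun w => gam u w ^+ 2 * gam v w ^+ 2); last first.
      by apply/funext => w; ring.
    by rewrite pairs// ?eqxx /= ?mulr1n ?mulr0n; ring.
  rewrite (_ : (fun w => _) = fun w => gam v w * (gam u w * gam s w * gam u w)); last first.
    by apply/funext => w; ring.
  by rewrite isolated3// 1?eq_sym// ?eqxx /= ?mulr1n ?mulr0n; ring.
rewrite (_ : (fun w => _) = fun w => gam u w * (gam v w * gam s w * gam t w)); last first.
  by apply/funext => w; ring.
by rewrite isolated3// 1?eq_sym// ?eqxx /= ?mulr1n ?mulr0n; ring.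
Qed.

Let sum_delta (J : finType) (f : J -> Rl[i]) x : \sum_y (x == y)%:R * f y = f x.
Proof.
rewrite (bigD1 x)//= eqxx mul1r big1 ?addr0// => y /negbTE.
by rewrite eq_sym => ->; rewrite mul0r.
Qed.

(** Each pairing collapses the fourfold sum to a double sum of covariances, which [H] dominates. The
    bound is used for the mean of the variance given [g] and for every diagonal term of the mean
    square error. *)
Lemma wick_sum_le c :
  \sum_u \sum_v \sum_s \sum_t E (gprod u v s t) * E (fun w => D c u v w * conjc (D c s t w))
  <= 3 * (((d ^ 2 + d) ^ k)%N)%:R.
Proof.
rewrite -/F.
have S1 : \sum_u \sum_v \sum_s \sum_t (u == v)%:R * (s == t)%:R * F c u v s t =
    \sum_u \sum_s F c u u s s.
  apply: eq_bigr => u _; rewrite -(sum_delta (fun v => \sum_s F c u v s s)).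
  apply: eq_bigr => v _; rewrite mulr_sumr; apply: eq_bigr => s _.
  by rewrite -(sum_delta (fun t => F c u v s t)) mulr_sumr; apply: eq_bigr => t _; rewrite mulrA.
have S2 : \sum_u \sum_v \sum_s \sum_t (u == s)%:R * (v == t)%:R * F c u v s t =
    \sum_u \sum_v F c u v u v.
  apply: eq_bigr => u _; apply: eq_bigr => v _.
  rewrite -(sum_delta (fun s => F c u v s v)); apply: eq_bigr => s _.
  by rewrite -(sum_delta (fun t => F c u v s t)) mulr_sumr; apply: eq_bigr => t _; rewrite mulrA.
have S3 : \sum_u \sum_v \sum_s \sum_t (u == t)%:R * (v == s)%:R * F c u v s t =
    \sum_u \sum_v F c u v v u.
  apply: eq_bigr => u _; apply: eq_bigr => v _.
  rewrite -(sum_delta (fun s => F c u v s u)); apply: eq_bigr => s _.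
  rewrite -(sum_delta (fun t => F c u v s t)) mulr_sumr; apply: eq_bigr => t _.
  by rewrite mulrA [(v == s)%:R * _]mulrC.
have -> : \sum_u \sum_v \sum_s \sum_t E (gprod u v s t) * F c u v s t =
    \sum_u \sum_s F c u u s s + \sum_u \sum_v F c u v u v + \sum_u \sum_v F c u v v u.
  rewrite -S1 -S2 -S3 -!big_split; apply: eq_bigr => u _.
  rewrite -!big_split; apply: eq_bigr => v _; rewrite -!big_split; apply: eq_bigr => s _.
  rewrite -!big_split; apply: eq_bigr => t _.
  by rewrite E_gprod /= !mulrDl.
pose SH := \sum_u \sum_v H u v; rewrite -sum_H -/SH.
rewrite (_ : 3 * SH = SH + SH + SH); last by ring.
by apply: lerD; [apply: lerD|]; apply: ler_sum => u _; apply: ler_sum => v _.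
Qed.

(** * The variance for a fixed [g] *)

Definition varpoly c (g : tidx d k -> Rl) : Rl[i] :=
  \sum_u \sum_v \sum_s \sum_t (g u * g v * (g s * g t))%:C%C * F c u v s t.

Lemma qform_centered c (g : tidx d k -> Rl) w :
  qform (outer g) (xtens Y c w) - (mtrace (outer g))%:C%C =
  \sum_u \sum_v (g u * g v)%:C%C * D c u v w.
Proof.
have -> : (mtrace (outer g))%:C%C = \sum_u \sum_v (u == v)%:R * (g u * g v)%:C%C.
  by rewrite /mtrace rmorph_sum; apply: eq_bigr => u _; rewrite sum_delta.
rewrite /qform -sumrB; apply: eq_bigr => u _; rewrite -sumrB; apply: eq_bigr => v _.
by rewrite /centered /xouter /outer; ring.
Qed.

Let pXc c (g : tidx d k -> Rl) :
  cpoly Y (xcset c) (fun w => \sum_u \sum_v (g u * g v)%:C%C * D c u v w).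
Proof. by apply: cpoly_sum => u; apply: cpoly_sum => v; apply: cpolyZ; exact: pD. Qed.

Let sum4M (a b : tidx d k -> tidx d k -> Rl[i]) :
  (\sum_u \sum_v a u v) * (\sum_s \sum_t b s t) =
  \sum_u \sum_v \sum_s \sum_t a u v * b s t.
Proof.
rewrite mulr_suml; apply: eq_bigr => u _; rewrite mulr_suml; apply: eq_bigr => v _.
by rewrite mulr_sumr; apply: eq_bigr => s _; rewrite mulr_sumr.
Qed.

Let Re_normsq (z : Rl[i]) :
  complex.Re (z * conjc z) = complex.Re z ^+ 2 + complex.Im z ^+ 2.
Proof. by case: z => x y /=; ring. Qed.

Let EFin_Re S Z : cpoly Y S Z -> (\int[P]_w (complex.Re (Z w))%:E = (complex.Re (E Z))%:E)%E.
Proof.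
move=> pZ; rewrite /cexpectation /= /Rintegral fineK//; apply: integrable_fin_num => //.
exact: (integrable_Re_cpoly mY indepY intY pZ).
Qed.

Lemma cvariance_cpoly S Z m : cpoly Y S Z -> E Z = m ->
  cvariance P Z = (complex.Re (E (fun w => (Z w - m) * conjc (Z w - m))))%:E.
Proof.
move=> pZ EZm.
have pZm : cpoly Y S (fun w => Z w - m) by apply: cpolyB => //; exact: cpoly_cst.
have pU := cpolyM pZm (cpoly_conj pZm).
rewrite -(EFin_Re pU).
have /integrableP[/measurable_EFinP mRe _] := integrable_Re_cpoly mY indepY intY pZm.
have /integrableP[/measurable_EFinP mIm _] := integrable_Im_cpoly mY indepY intY pZm.
under eq_integral do rewrite Re_normsq EFinD.
rewrite ge0_integralD//; last 4 first.
- by move=> w _; rewrite lee_fin sqr_ge0.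
- by apply/measurable_EFinP; exact: measurable_funX.
- by move=> w _; rewrite lee_fin sqr_ge0.
- by apply/measurable_EFinP; exact: measurable_funX.
rewrite /cvariance /variance !unlock; congr (_ + _)%E; apply: eq_integral => w _ /=.
- have -> : fine (\int[P]_w (complex.Re (Z w))%:E) = complex.Re m by rewrite -EZm.
  by rewrite raddfB/= expr2.
- have -> : fine (\int[P]_w (complex.Im (Z w))%:E) = complex.Im m by rewrite -EZm.
  by rewrite raddfB/= expr2.
Qed.

(** For deterministic [g] the centered form is linear in the [D c u v], so its variance is a quartic
    form in [g] with covariances as coefficients. Evaluated at [gvec Y w], this form is the variance
    given [g], and its mean involves only moments of [g]. *)
Lemma cvariance_qform c (g : tidx d k -> Rl) :
  cvariance P (fun w => qform (outer g) (xtens Y c w)) = (complex.Re (varpoly c g))%:E.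
Proof.
set m := (mtrace (outer g))%:C%C.
have qE w : qform (outer g) (xtens Y c w) =
    \sum_u \sum_v (g u * g v)%:C%C * D c u v w + m.
  by rewrite -qform_centered subrK.
have pC (x : Rl[i]) := cpoly_cst Y (xcset c) x.
have pq : cpoly Y (xcset c) (fun w => qform (outer g) (xtens Y c w)).
  under eq_fun do rewrite qE; exact: cpolyD.
have Eq : E (fun w => qform (outer g) (xtens Y c w)) = m.
  under eq_fun do rewrite qE; rewrite (ED (pXc c g) (pC m)) EC.
  rewrite (Esum (S := xcset c)) ?big1 ?add0r// => u.
    move=> _; rewrite (Esum (S := xcset c)) ?big1// => v.
      by move=> _; rewrite (EZ _ (pD c u v)) cexpectation_centered mulr0.
    by apply: cpolyZ; exact: pD.
  by apply: cpoly_sum => v; apply: cpolyZ; exact: pD.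
rewrite (cvariance_cpoly pq Eq); congr (complex.Re _)%:E.
under eq_fun.
  move=> w; rewrite qE addrK rmorph_sum.
  under [X in _ * X]eq_bigr do rewrite rmorph_sum.
  rewrite sum4M; over.
have pDD u v s t := cpolyM (pD c u v) (cpoly_conj (pD c s t)).
have tE u v s t w : (g u * g v)%:C%C * D c u v w * conjc ((g s * g t)%:C%C * D c s t w) =
    (g u * g v * (g s * g t))%:C%C * (D c u v w * conjc (D c s t w)).
  have -> : conjc ((g s * g t)%:C%C * D c s t w) = (g s * g t)%:C%C * conjc (D c s t w).
    by rewrite rmorphM; congr (_ * _); exact: conjc_real.
  have -> : (g u * g v * (g s * g t))%:C%C = (g u * g v)%:C%C * (g s * g t)%:C%C :> Rl[i].
    exact: rmorphM.
  by rewrite mulrACA.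
have pt u v s t : cpoly Y (xcset c)
    (fun w => (g u * g v)%:C%C * D c u v w * conjc ((g s * g t)%:C%C * D c s t w)).
  by under eq_fun do rewrite tE; exact: cpolyZ.
rewrite (Esum (S := xcset c)); last by move=> u; do 3! apply: cpoly_sum => ?; exact: pt.
apply: eq_bigr => u _; rewrite (Esum (S := xcset c)); last first.
  by move=> v; do 2! apply: cpoly_sum => ?; exact: pt.
apply: eq_bigr => v _; rewrite (Esum (S := xcset c)); last first.
  by move=> s; apply: cpoly_sum => ?; exact: pt.
apply: eq_bigr => s _; rewrite (Esum (S := xcset c)); last by move=> t; exact: pt.
apply: eq_bigr => t _; under eq_fun do rewrite tE.
by rewrite (EZ _ (pDD u v s t)).
Qed.

Let Re_le (x y : Rl[i]) : x <= y -> complex.Re x <= complex.Re y.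
Proof. by rewrite lecE => /andP[]. Qed.

Let Re_natM (n m : nat) : complex.Re (n%:R * m%:R : Rl[i]) = n%:R * m%:R.
Proof. by rewrite -natrM -(rmorph_nat (real_complex Rl)) /= natrM. Qed.

Let pgprod u v s t : cpoly Y gset (gprod u v s t).
Proof. by do 2! [apply: cpolyM]; apply: pgam; eexists. Qed.

Let gprodE u v s t w :
  (gvec Y w u * gvec Y w v * (gvec Y w s * gvec Y w t))%:C%C = gprod u v s t w.
Proof. by rewrite /gprod /gam /yv /gvec !rmorphM. Qed.

Lemma varpoly_gvec c : cpoly Y gset (fun w => varpoly c (gvec Y w)) /\
  complex.Re (E (fun w => varpoly c (gvec Y w))) <= 3 * (((d ^ 2 + d) ^ k)%N)%:R.
Proof.
have pt u v s t : cpoly Y gset (fun w =>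
    (gvec Y w u * gvec Y w v * (gvec Y w s * gvec Y w t))%:C%C * F c u v s t).
  by under eq_fun do rewrite gprodE mulrC; apply: cpolyZ; exact: pgprod.
split; first by rewrite /varpoly; do 4! apply: cpoly_sum => ?; exact: pt.
rewrite -Re_natM; apply: Re_le; apply: le_trans (wick_sum_le c).
rewrite /varpoly le_eqVlt; apply/orP; left; apply/eqP.
rewrite (Esum (S := gset)); last by move=> u; do 3! apply: cpoly_sum => ?; exact: pt.
apply: eq_bigr => u _; rewrite (Esum (S := gset)); last first.
  by move=> v; do 2! apply: cpoly_sum => ?; exact: pt.
apply: eq_bigr => v _; rewrite (Esum (S := gset)); last first.
  by move=> s; apply: cpoly_sum => ?; exact: pt.
apply: eq_bigr => s _; rewrite (Esum (S := gset)); last by move=> t; exact: pt.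
apply: eq_bigr => t _; under eq_fun do rewrite gprodE mulrC.
by rewrite (EZ _ (pgprod u v s t)) mulrC.
Qed.

(** * The mean square error of the estimator *)

Definition hutch_error w : Rl[i] :=
  hutch (outer (gvec Y w)) (fun c => xtens Y c w) - (mtrace (outer (gvec Y w)))%:C%C.

Let A c w := \sum_u \sum_v (gvec Y w u * gvec Y w v)%:C%C * D c u v w.

Let hutch_errorE w : (0 < l)%N ->
  hutch_error w = ((l%:R)^-1)%:C%C * \sum_c A c w.
Proof.
move=> l0; rewrite /A.
under [in RHS]eq_bigr do rewrite -qform_centered.
rewrite sumrB sumr_const card_ord mulrBr /hutch_error /hutch; congr (_ - _).
set m := (_ (mtrace _)).
transitivity (((l%:R)^-1)%:C%C * l%:R * m); last by rewrite -mulrA mulr_natl.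
rewrite -(rmorph_nat (real_complex Rl)) -rmorphM mulVf ?rmorph1 ?mul1r//.
by rewrite pnatr_eq0 -lt0n.
Qed.

Let gg_sub u v : cpoly Y setT (fun w => (gvec Y w u * gvec Y w v)%:C%C).
Proof.
by under eq_fun do rewrite rmorphM; apply: cpolyM; apply: cpoly_var.
Qed.

Let pA c : cpoly Y setT (A c).
Proof.
apply: cpoly_sum => u; apply: cpoly_sum => v; apply: cpolyM; first exact: gg_sub.
exact: cpolyW (pD c u v).
Qed.

Lemma cpoly_hutch_error : (0 < l)%N -> cpoly Y setT hutch_error.
Proof.
move=> l0; have -> : hutch_error = fun w => ((l%:R)^-1)%:C%C * \sum_c A c w.
  by apply/funext => w; exact: hutch_errorE.
by apply: cpolyZ; apply: cpoly_sum.
Qed.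

Let E_AA c c' : E (fun w => A c w * conjc (A c' w)) =
  \sum_u \sum_v \sum_s \sum_t E (gprod u v s t) * E (fun w => D c u v w * conjc (D c' s t w)).
Proof.
pose B := xcset c `|` xcset c'.
have pDD u v s t : cpoly Y B (fun w => D c u v w * conjc (D c' s t w)).
  apply: cpolyM; first by apply: cpolyW (pD c u v); exact: subsetUl.
  by apply: cpoly_conj; apply: cpolyW (pD c' s t); exact: subsetUr.
have tE u v s t w : (gvec Y w u * gvec Y w v)%:C%C * D c u v w *
    conjc ((gvec Y w s * gvec Y w t)%:C%C * D c' s t w) =
    gprod u v s t w * (D c u v w * conjc (D c' s t w)).
  rewrite -gprodE.
  have -> : conjc ((gvec Y w s * gvec Y w t)%:C%C * D c' s t w) =
      (gvec Y w s * gvec Y w t)%:C%C * conjc (D c' s t w).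
    by rewrite rmorphM; congr (_ * _); exact: conjc_real.
  by rewrite mulrACA; congr (_ * _); rewrite -rmorphM.
have pt u v s t : cpoly Y setT (fun w => (gvec Y w u * gvec Y w v)%:C%C * D c u v w *
    conjc ((gvec Y w s * gvec Y w t)%:C%C * D c' s t w)).
  under eq_fun do rewrite tE; apply: cpolyM; first exact: cpolyW (pgprod u v s t).
  exact: cpolyW (pDD u v s t).
under eq_fun.
  move=> w; rewrite /A rmorph_sum.
  under [X in _ * X]eq_bigr do rewrite rmorph_sum.
  rewrite sum4M; over.
rewrite (Esum (S := setT)); last by move=> u; do 3! apply: cpoly_sum => ?; exact: pt.
apply: eq_bigr => u _; rewrite (Esum (S := setT)); last first.
  by move=> v; do 2! apply: cpoly_sum => ?; exact: pt.
apply: eq_bigr => v _; rewrite (Esum (S := setT)); last first.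
  by move=> s; apply: cpoly_sum => ?; exact: pt.
apply: eq_bigr => s _; rewrite (Esum (S := setT)); last by move=> t; exact: pt.
apply: eq_bigr => t _; under eq_fun do rewrite tE.
(* [gprod] involves only [inl] variables and the [D] factors only [inr] ones, so the moment of [g]
   separates even though both copies share [g]. *)
rewrite (EM (pgprod u v s t) (pDD u v s t))//.
by apply/seteqP; split=> i //= [[x ->] [[j [a [b]]]|[j [a [b]]]]].
Qed.

(** [A c] and [A c'] both involve [g] and are not independent. Once the moments of [g] are factored
    out, what remains are products of centered polynomials in disjoint sets of variables. *)
Let E_AA_neq c c' : c != c' -> E (fun w => A c w * conjc (A c' w)) = 0.
Proof.
move=> cc'; rewrite E_AA big1// => u _; rewrite big1// => v _; rewrite big1// => s _.
rewrite big1// => t _; rewrite (EM (pD c u v) (cpoly_conj (pD c' s t))).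
  by rewrite cexpectation_centered mul0r mulr0.
apply/seteqP; split=> i //= [[j [a [b ->]]] [j' [a' [b' [e]]]]].
by rewrite e eqxx in cc'.
Qed.

Lemma cexpectation_hutch_error : (0 < l)%N ->
  complex.Re (E (fun w => hutch_error w * conjc (hutch_error w))) <=
  3 * (((d ^ 2 + d) ^ k)%N)%:R / l%:R.
Proof.
move=> l0; set L : Rl[i] := ((l%:R)^-1)%:C%C.
have pAA c c' := cpolyM (pA c) (cpoly_conj (pA c')).
have -> : (fun w => hutch_error w * conjc (hutch_error w)) =
    fun w => L ^+ 2 * \sum_c \sum_c' A c w * conjc (A c' w).
  apply/funext => w; rewrite (hutch_errorE w l0) -/L.
  have -> : conjc (L * \sum_c A c w) = L * \sum_c conjc (A c w).
    rewrite rmorphM rmorph_sum; congr (_ * _); exact: conjc_real.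
  rewrite mulrACA -expr2 mulr_suml; congr (_ * _).
  by apply: eq_bigr => c _; rewrite mulr_sumr.
rewrite (EZ (S := setT)); last by do 2! apply: cpoly_sum => ?; exact: pAA.
rewrite (Esum (S := setT)); last by move=> c; apply: cpoly_sum => ?; exact: pAA.
set Z := \sum_c _.
(* Only the [l] diagonal terms survive; against the factor [L ^+ 2 = l^-2] they leave [1 / l]. *)
have ZE : Z <= l%:R * (3 * (((d ^ 2 + d) ^ k)%N)%:R).
  rewrite mulr_natl -[X in _ *+ X]card_ord -sumr_const; apply: ler_sum => c _.
  rewrite (Esum (S := setT)); last by move=> c'; exact: pAA.
  rewrite (bigD1 c)//= big1 ?addr0; last by move=> c' cc'; apply: E_AA_neq; rewrite eq_sym.
  by rewrite E_AA wick_sum_le.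
have L0 : 0 <= L ^+ 2.
  by rewrite exprn_ge0// lecR invr_ge0.
have := Re_le (ler_wpM2l L0 ZE).
rewrite (_ : L ^+ 2 * (l%:R * (3 * (((d ^ 2 + d) ^ k)%N)%:R)) =
  (3 * (((d ^ 2 + d) ^ k)%N)%:R / l%:R)%:C%C)//.
rewrite -!(rmorph_nat (real_complex Rl)) /L -rmorphXn -!rmorphM; congr (_)%:C%C.
by field; rewrite pnatr_eq0 -lt0n.
Qed.

End model_moments.

(** * The Kronecker-Hutchinson model *)

Section kh_model_moments.
Context {dT : measure_display} {T : measurableType dT} (P : probability T Rl).
Context {d k l : nat} (kind : 'I_k -> bool) (Y : kh_index d k l -> T -> Rl).
Hypothesis HY : kh_model P kind Y.

Lemma kh_model_law i : std_normal P (Y i) \/ rademacher P (Y i).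
Proof.
case: HY => _ _ hg hx; case: i => [u|[[[c j] a] b]]; first by left.
by have := hx c j a b; case: (kind j); [left|right].
Qed.

Let mX n : measurable_fun [set: RM] (fun x : RM => x ^+ n : RM).
Proof. exact: (@measurable_funX _ _ Rl). Qed.

Lemma kh_model_integrable i n : P.-integrable [set: T] (fun w => (Y i w ^+ n)%:E).
Proof.
have [mY _ _ _] := HY; have [h|[h1 hN1]] := kh_model_law i.
  exact: (@integrable_normalX _ _ Rl P _ (mY i) h).
exact: (@integrable_rademacher _ _ Rl P _ (mY i) h1 hN1 (fun x => x ^+ n)).
Qed.

Lemma kh_model_moment1 i : \int[P]_w Y i w = 0.
Proof.
have [mY _ _ _] := HY; have [h|[h1 hN1]] := kh_model_law i.
  exact: (@Rintegral_normal1 _ _ Rl P _ (mY i) h).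
have := @Rintegral_rademacher _ _ Rl P _ (mY i) h1 hN1 (fun x => x ^+ 1) (mX 1).
by rewrite !expr1 subrr mul0r.
Qed.

Lemma kh_model_moment2 i : \int[P]_w (Y i w ^+ 2) = 1.
Proof.
have [mY _ _ _] := HY; have [h|[h1 hN1]] := kh_model_law i.
  exact: (@Rintegral_normal2 _ _ Rl P _ (mY i) h).
rewrite (@Rintegral_rademacher _ _ Rl P _ (mY i) h1 hN1 (fun x => x ^+ 2) (mX 2)).
by rewrite sqrrN expr1n; lra.
Qed.

Lemma kh_model_moment4_gauss u : \int[P]_w (Y (inl u) w ^+ 4) = 3.
Proof. by have [mY _ h _] := HY; exact: (@Rintegral_normal4 _ _ Rl P _ (mY _) (h u)). Qed.

Lemma kh_model_moment4 i : \int[P]_w (Y i w ^+ 4) <= 3.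
Proof.
have [mY _ _ _] := HY; have [h|[h1 hN1]] := kh_model_law i.
  by rewrite (@Rintegral_normal4 _ _ Rl P _ (mY i) h).
rewrite (@Rintegral_rademacher _ _ Rl P _ (mY i) h1 hN1 (fun x => x ^+ 4) (mX 4)).
by rewrite exprNn expr1n; lra.
Qed.

Lemma measurable_mtrace : measurable_fun [set: T] (fun w => mtrace (outer (gvec Y w)) : RM).
Proof.
have [mY _ _ _] := HY; apply: (@measurable_sum _ _ Rl) => u.
by apply: (@measurable_funM _ _ Rl); exact: mY.
Qed.

Lemma mtrace_ge0 w : 0 <= mtrace (outer (gvec Y w)).
Proof. by apply: sumr_ge0 => u _; rewrite /outer -expr2 sqr_ge0. Qed.

Lemma mtrace_small_ball : (0 < #|{: tidx d k}|)%N ->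
  (P [set w | mtrace (outer (gvec Y w)) < (d%:R ^+ k) / 2048]%R <= (1 / 8)%:E)%E.
Proof.
move=> U0; have [mY _ hg _] := HY.
have := @sqr_norm_small_ball _ _ Rl P _ (fun u => Y (inl u)) (fun u => mY _) hg U0.
by rewrite card_ffun !card_ord natrX.
Qed.

End kh_model_moments.

(** * From moments to the two probability bounds *)

Lemma moment_bound_factor (d k : nat) :
  (((d ^ 2 + d) ^ k)%N)%:R = (d%:R ^+ k) ^+ 2 * (1 + d%:R^-1) ^+ k :> Rl.
Proof.
rewrite -exprM mulnC exprM -exprMn natrX; congr (_ ^+ k); rewrite natrD natrX.
(* For [d = 0] the convention [0^-1 = 0] makes both sides vanish. *)
have [->|d0] := eqVneq d 0%N; first by rewrite expr0n/= mul0r addr0.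
by field; rewrite pnatr_eq0.
Qed.

Lemma normc_le (z : Rl[i]) (t : Rl) : 0 <= t ->
  (cmod z <= t) = (complex.Re (z * conjc z) <= t ^+ 2).
Proof.
move=> t0; case: z => x y; rewrite /cmod /=.
rewrite (_ : x * x - y * - y = x ^+ 2 + y ^+ 2); last by ring.
rewrite -{2}[x ^+ 2 + y ^+ 2]sqr_sqrtr ?addr_ge0 ?sqr_ge0//.
by rewrite ler_pXn2r// nnegrE sqrtr_ge0.
Qed.

Theorem theorem7 :
  exists C : Rl, 0 < C /\
  forall (d k : nat) (kind : 'I_k -> bool),
    (* (i) *)
    (forall (dT : measure_display) (T : measurableType dT)
            (P : probability T Rl) (Y : kh_index d k 1 -> T -> Rl),
       kh_model P kind Y ->
       ((3 / 4)%:E <=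
        P [set w | (cvariance P (fun w' => qform (outer (gvec Y w)) (xtens Y ord0 w'))
                    <= (C * (1 + d%:R^-1) ^+ k * (mtrace (outer (gvec Y w))) ^+ 2)%:E)%E])%E)
    /\
    (* (ii) *)
    (forall (eps : Rl), 0 < eps < 1 ->
     forall l : nat, C * eps^-2 * (1 + d%:R^-1) ^+ k <= l%:R ->
     forall (dT : measure_display) (T : measurableType dT)
            (P : probability T Rl) (Y : kh_index d k l -> T -> Rl),
       kh_model P kind Y ->
       ((2 / 3)%:E <=
        P [set w | (cmod (hutch (outer (gvec Y w)) (fun c => xtens Y c w)
                          - (mtrace (outer (gvec Y w)))%:C%C)
                   <= eps * mtrace (outer (gvec Y w)))%R])%E).
Proof.
(* [2048] is kept opaque: reducing the unary numeral in [Rl] does not terminate in practice. *)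
have [e eE e0] : exists2 e : Rl, e = 2048 & 0 < e.
  by exists 2048; [exact: erefl|rewrite ltr0n].
(* Here [24 = 8 * 3]: Markov at level 1/8 costs 8 and the Wick pairings give 3. The factor [e ^+ 2]
   is the price of replacing [n ^+ 2] by the squared trace, since the trace is at least [n / e] on
   the good event. *)
exists (24 * e ^+ 2); split; first by rewrite mulr_gt0// exprn_gt0.
have le34 : 3 / 4 <= 1 :> Rl by lra.
have le23 : 2 / 3 <= 3 / 4 :> Rl by lra.
move=> d k kind; set L : Rl := (1 + d%:R^-1) ^+ k.
have L0 : 0 < L by rewrite exprn_gt0// ltr_wpDr// invr_ge0.
have a0 : (0 < #|{: tidx d k}|)%N -> 0 < d%:R ^+ k / e :> Rl.
  by move=> U0; rewrite divr_gt0// -natrX ltr0n; move: U0; rewrite card_ffun !card_ord.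
split.
- move=> dT T P Y HY; have [mY indepY hg _] := HY.
  have intY := kh_model_integrable HY; have Y1 := kh_model_moment1 HY.
  have Y2 := kh_model_moment2 HY; have Y4 := kh_model_moment4 HY.
  have Y4g := kh_model_moment4_gauss HY.
  have [pV EV] := varpoly_gvec mY indepY intY Y1 Y2 Y4 Y4g ord0.
  set V := varpoly P Y ord0 in pV EV.
  have varE := cvariance_qform mY indepY intY Y1 Y2 ord0.
  have -> : [set w | (cvariance P (fun w' => qform (outer (gvec Y w)) (xtens Y ord0 w'))
      <= (24 * e ^+ 2 * L * (mtrace (outer (gvec Y w))) ^+ 2)%:E)%E] =
    [set w | complex.Re (V (gvec Y w)) <= 24 * e ^+ 2 * L * (mtrace (outer (gvec Y w))) ^+ 2].
    by apply/seteqP; split => w /=; rewrite varE lee_fin.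
  (* The quartic form has no visible sign; it is nonnegative because it is a variance. *)
  have V0 w : 0 <= complex.Re (V (gvec Y w)).
    by rewrite -lee_fin -varE adde_ge0// variance_ge0.
  (* If [d = 0 < k] there is no multi-index and the threshold [d^k / e] is not positive, so Markov
     does not apply; but all sums are empty and the inequality reads [0 <= 0]. *)
  have [U0|U0] := posnP #|{: tidx d k}|.
    have U_void (u : tidx d k) : False by move: U0; rewrite (cardD1 u) inE.
    rewrite (_ : [set w | _] = setT) ?probability_setT ?lee_fin//.
    apply/seteqP; split => // w _ /=; rewrite /V /varpoly /mtrace !big1.
      by rewrite expr0n mulr0.
      by move=> u; have := U_void u.
    by move=> u; have := U_void u.
  apply: (@good_event_ge _ _ Rl P _ _ (3 * (((d ^ 2 + d) ^ k)%N)%:R) _ (d%:R ^+ k / e)) => //.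
  + exact: (integrable_Re_cpoly mY indepY intY pV).
  + exact: (measurable_mtrace HY).
  + exact: mtrace_ge0.
  + by rewrite eE; exact: (mtrace_small_ball HY).
  + by rewrite !mulr_gt0// exprn_gt0.
  + exact: a0.
  + rewrite moment_bound_factor -/L le_eqVlt; apply/orP; left; apply/eqP.
    by field; rewrite gt_eqF.
- move=> eps /andP[eps0 eps1] l hl dT T P Y HY; have [mY indepY hg _] := HY.
  have intY := kh_model_integrable HY; have Y1 := kh_model_moment1 HY.
  have Y2 := kh_model_moment2 HY; have Y4 := kh_model_moment4 HY.
  have Y4g := kh_model_moment4_gauss HY.
  have lR0 : 0 < l%:R :> Rl.
    by apply: lt_le_trans hl; rewrite !mulr_gt0// ?exprn_gt0// invr_gt0 exprn_gt0.
  have l0 : (0 < l)%N by move: lR0; rewrite ltr0n.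
  have pE := cpoly_hutch_error Y l0.
  have EE := cexpectation_hutch_error mY indepY intY Y1 Y2 Y4 Y4g l0.
  have -> : [set w | cmod (hutch (outer (gvec Y w)) (fun c => xtens Y c w)
        - (mtrace (outer (gvec Y w)))%:C%C) <= eps * mtrace (outer (gvec Y w))] =
      [set w | complex.Re (hutch_error Y w * conjc (hutch_error Y w))
        <= eps ^+ 2 * mtrace (outer (gvec Y w)) ^+ 2].
    by apply/seteqP; split => w /=; rewrite normc_le ?exprMn// mulr_ge0 ?mtrace_ge0 ?ltW.
  (* The joint average over [g] and all copies gives probability 3/4, more than the claim asks. *)
  apply: (@le_trans _ _ (3 / 4)%:E); first by rewrite lee_fin.
  have [U0|U0] := posnP #|{: tidx d k}|.
    have U_void (u : tidx d k) : False by move: U0; rewrite (cardD1 u) inE.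
    rewrite (_ : [set w | _] = setT) ?probability_setT ?lee_fin//.
    apply/seteqP; split => // w _ /=.
    have -> : hutch_error Y w = 0.
      rewrite /hutch_error /hutch /mtrace !big1 ?mulr0 ?subrr// => c _.
      by rewrite /qform big1// => v; have := U_void v.
    by rewrite mul0r mulr_ge0 ?sqr_ge0.
  apply: (@good_event_ge _ _ Rl P _ _ (3 * (((d ^ 2 + d) ^ k)%N)%:R / l%:R) _ (d%:R ^+ k / e)) => //.
  + exact: (integrable_Re_cpoly mY indepY intY (cpolyM pE (cpoly_conj pE))).
  + exact: (measurable_mtrace HY).
  + by move=> w; case: (hutch_error Y w) => x y /=; rewrite mulrN opprK -!expr2 addr_ge0 ?sqr_ge0.
  + exact: mtrace_ge0.
  + by rewrite eE; exact: (mtrace_small_ball HY).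
  + by rewrite exprn_gt0.
  + exact: a0.
  (* Multiplied by [n ^+ 2 / (e ^+ 2 * l)], with [n = d^k], the hypothesis on [l] becomes exactly
     the inequality that [good_event_ge] requires. *)
  + rewrite moment_bound_factor -/L.
    have h : 24 * e ^+ 2 * L <= eps ^+ 2 * l%:R.
      by move: hl; rewrite -/L mulrAC ler_pdivrMr ?exprn_gt0// [X in _ <= X]mulrC.
    set x : Rl := (d%:R ^+ k) ^+ 2; have x0 : 0 <= x by rewrite sqr_ge0.
    have -> : 8 * (3 * (x * L) / l%:R) = x * (24 * e ^+ 2 * L) / (e ^+ 2 * l%:R).
      by field; rewrite !gt_eqF.
    have -> : eps ^+ 2 * (d%:R ^+ k / e) ^+ 2 = x * (eps ^+ 2 * l%:R) / (e ^+ 2 * l%:R).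
      by rewrite /x; field; rewrite !gt_eqF.
    by rewrite ler_pM2r ?invr_gt0 ?mulr_gt0 ?exprn_gt0// ler_wpM2l.
Qed.
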